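(* Let $p(x)$ be a real polynomial of even degree $n$, and let $PP=\frac{p''p}{(p')^2}$. Then $$\sharp_r\big[(n-1)(p'(x))^2-n\,p(x)p''(x)\big]+\sharp_r\, p(x)>0$$ if and only if $$PP\in \Lambda_1\cup\Lambda_{21}\cup\Lambda_{22}\cup\Gamma_{122}\cup\Gamma_{22}\cup\Gamma_{2122}\cup\Gamma_{211}\cup\Gamma_{231}\cup\Gamma_{2322}.$$
   Context: $\sharp_r q$ denotes the number of real zeros of a polynomial $q$. Root locus terminology. For a real polynomial $p$ of even degree $n$, put $PP(s)=\frac{p''(s)p(s)}{p'(s)^2}$ and consider the equation $K\cdot PP(s)=\pm1$, where the gain is $K=K(s)=\left|\frac{p'(s)^2}{p''(s)p(s)}\right|$ ($K=0$ at poles of $PP$, $K=+\infty$ at zeros of $PP$). Put $K_0=\frac{n}{n-1}$. The points where the right-hand side is $1$ (argument of $PP$ equal to $2q\pi$, $q\in\mathbb Z$, i.e. $PP$ is positive real) form curves called root loci of $2q\pi$ degree; those where it is $-1$ (argument $2q\pi+\pi$, i.e. $PP$ is negative real) form curves called root loci of $2q\pi+\pi$ degree. A (single) root locus is an entire branch going from a starting point (a pole, or infinity) to an ending point (a zero, or infinity); it is said to extend in the direction from its pole to its zero. A breakaway point is a point, neither a zero nor a pole, where at least two root loci intersect. A real breakaway point is standard if on the real axis two distinct root loci lie on its two sides, either both extending toward it or both extending away from it; it is non-standard if only one root locus lies on the real axis on its two sides (passing through it). A standard real breakaway point is a maximum (respectively minimum) real breakaway point if the gain $K$, on the real axis, attains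 a local maximum (respectively local minimum) there. A real interval is a root locus of $2q\pi$ degree if its points have argument $2q\pi$, i.e. $PP>0$ on it. Classes. $\Lambda$ is the set of all $PP=\frac{p''p}{(p')^2}$ with $p$ a real polynomial of even degree $n$. ''$PP\in X$'' means that $p$ has the property defining $X$. $\Lambda_1$: $p$ has real zeros. $\Lambda_2$: $p$ has no real zeros. $\Lambda_2$ is the disjoint union of: - $\Lambda_{21}$: $p'$ has at least three real zeros; if $p'$ has real multiple zeros, it has at least two distinct real zeros. - $\Lambda_{22}$: $p'$ has exactly one distinct real zero, and its multiplicity is larger than $1$. - $\Lambda_{23}=:\Gamma$: $p'$ has exactly one real zero, denoted $p_0$, and it is simple. $\Gamma_1\subseteq\Gamma$: $p''$ has no real zeros. $\Gamma_2\subseteq\Gamma$: $p''$ has a real zero. $\Gamma_{12}\subseteq\Gamma_1$: the root loci of $PP$ have at least one standard real breakaway point. $\Gamma_{122}\subseteq\Gamma_{12}$: there is at least one maximum real breakaway point $b$ with $K(b)\ge K_0$. $\Gamma_{21}\subseteq\Gamma_2$: $p''$ has real zeros to the right of $p_0$ and none to the left. $\Gamma_{22}\subseteq\Gamma_2$: $p''$ has real zeros to the left of $p_0$ and none to the right. $\Gamma_{23}\subseteq\Gamma_2$: $p''$ has real zeros both to the right and to the left of $p_0$. Intervals. When they exist, let $z_m$ be the largest real zero of $p''$ to the right of $p_0$, and $z_s$ the smallest real zero of $p''$ to the left of $p_0$. $(z_m,+\infty)$ is the right infinite interval. If $(-\infty,z_s)$ is a root locus of $2q\pi$ degree, it is called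 the left infinite interval of $2q\pi$ degree. For two adjacent real zeros $z_1<z_2$ of $p''$, both to the right or both to the left of $p_0$, if $(z_1,z_2)$ is a root locus of $2q\pi$ degree it is called a finite interval of $2q\pi$ degree. $\Gamma_{211}\subseteq\Gamma_{21}$ (respectively $\Gamma_{212}\subseteq\Gamma_{21}$): $p''$ has an even (respectively odd) number of real zeros, counted with multiplicity, to the right of $p_0$. $\Gamma_{2122}\subseteq\Gamma_{212}$: in the right infinite interval, or in at least one finite interval of $2q\pi$ degree to the right of $p_0$ (if any exist), there is at least one minimum real breakaway point $b$ with $K(b)\le K_0$. $\Gamma_{231}\subseteq\Gamma_{23}$ (respectively $\Gamma_{232}\subseteq\Gamma_{23}$): $p''$ has an even (respectively odd) number of real zeros, counted with multiplicity, to the right of $p_0$. $\Gamma_{2322}\subseteq\Gamma_{232}$: in at least one of the following intervals (those which exist) there is at least one minimum real breakaway point $b$ with $K(b)\le K_0$: the right infinite interval, the finite intervals of $2q\pi$ degree to the right of $p_0$, the left infinite interval of $2q\pi$ degree, the finite intervals of $2q\pi$ degree to the left of $p_0$. *)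

(* Defs.v *)
From HB Require Import structures.
From mathcomp Require Import all_boot all_order all_algebra.
From mathcomp Require Import all_classical all_reals all_analysis.
From mathcomp Require Import polyorder polyrcf complex.

Set Implicit Arguments.
Unset Strict Implicit.
Unset Printing Implicit Defensive.

Import Order.TTheory GRing.Theory Num.Theory.
Import numFieldNormedType.Exports.
Import ComplexField.

Local Open Scope classical_set_scope.
Local Open Scope ring_scope.
Local Open Scope complex_scope.

Section RealZeros.
Variable R : realType.
Implicit Types (p q : {poly R}) (x : R).

(* Zeros are counted with multiplicity; [rootsR q] lists the distinct ones. *)
Definition nb_zeros_right q x : nat :=
  (\sum_(z <- rootsR q | (x < z)%R) \mu_z q)%N.

(* [rootsR 0 = [::]], whence the separate case. *)
Definition sharp_r q : \bar R :=
  if q == 0 then +oo%E else ((\sum_(z <- rootsR q) \mu_z q)%N%:R)%:E.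

End RealZeros.

Section RootLocus.
Variable R : realType.
(* [R[i]^o] is [R[i]] with the topology of its norm. *)
Local Notation C := (R[i]^o).
Implicit Types (p : {poly R}) (s : C) (x b : R) (L : set C).

(* PP is a rational function on the complex plane: it is written in lowest
   terms, so that a common zero of p''p and (p')^2 (a multiple zero of p) is
   neither a zero nor a pole of PP, as PP has a finite nonzero value there. *)
Definition PPnum p : {poly R} :=
  (p^`(2) * p) %/ gcdp (p^`(2) * p) (p^`() ^+ 2).
Definition PPden p : {poly R} :=
  (p^`() ^+ 2) %/ gcdp (p^`(2) * p) (p^`() ^+ 2).

Definition evalC (q : {poly R}) s : C := (map_poly (real_complex R) q).[s].

Definition PPzero p s : Prop := evalC (PPnum p) s = 0.
Definition PPpole p s : Prop := evalC (PPden p) s = 0.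

(* At a pole this is the default value 0 of the division. *)
Definition PP p s : C := evalC (PPnum p) s / evalC (PPden p) s.

Definition gain p s : \bar R :=
  if `[< PPzero p s >] then +oo%E
  else (complex.Re `|evalC (PPden p) s / evalC (PPnum p) s|)%:E.

Definition K0 p : \bar R :=
  let n := (size p).-1 in (n%:R / (n.-1)%:R)%:E.

Definition end_filter (k1 : \bar R) : set_system R :=
  if k1 is r%:E%E then r^'- else pinfty_nbhs R.

(* A root locus is a continuous branch k |-> g k of solutions of k * PP = 1
   (2q pi degree, e = false) or of k * PP = -1 (2q pi + pi degree, e = true),
   parametrized by the gain k, from a pole or infinity to a zero or infinity.
   Since the gain at g k is k, the curve L determines its parametrization, and
   the direction in which L extends is that of increasing gain. *)
Definition root_locus p L : Prop :=
  exists (e : bool) (k0 : R) (k1 : \bar R) (g : R -> C),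
    let I := [set k : R | k0 < k /\ (k%:E < k1)%E] in
    [/\ 0 <= k0 /\ (k0%:E < k1)%E,
        forall k, I k -> {for k, continuous g} /\
                         k%:C * PP p (g k) = (-1) ^+ e,
        (exists2 s, PPpole p s & g k @[k --> k0^'+] --> s) \/
          complex.Re `|g k| @[k --> k0^'+] --> +oo%R,
        (exists2 s, PPzero p s & g k @[k --> end_filter k1] --> s) \/
          complex.Re `|g k| @[k --> end_filter k1] --> +oo%R
      & L = g @` I].

(* At a breakaway point a branch may be continued along any outgoing arc, so
   two root loci can share a whole arc past that point; hence intersecting at s
   means that s is an isolated common point. *)
Definition breakaway p s : Prop :=
  [/\ ~ PPzero p s, ~ PPpole p s
    & exists L1 L2, [/\ root_locus p L1, root_locus p L2, L1 s, L2 s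
        & \forall z \near s^', ~ (L1 z /\ L2 z)]].

(* A root locus through b extends toward b along a one-sided real neighborhood
   of b that it contains iff the gain there is smaller than at b. *)
Definition standard_real_breakaway p b : Prop :=
  breakaway p b%:C /\
  exists L1 L2,
    [/\ root_locus p L1 /\ root_locus p L2, L1 <> L2,
        L1 b%:C /\ L2 b%:C,
        (\forall x \near b^'-, L1 x%:C) /\ (\forall x \near b^'+, L2 x%:C)
      & ((\forall x \near b^'-, (gain p x%:C < gain p b%:C)%E) /\
         (\forall x \near b^'+, (gain p x%:C < gain p b%:C)%E)) \/
        ((\forall x \near b^'-, (gain p b%:C < gain p x%:C)%E) /\
         (\forall x \near b^'+, (gain p b%:C < gain p x%:C)%E))].

Definition max_real_breakaway p b : Prop :=
  standard_real_breakaway p b /\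
  \forall x \near b, (gain p x%:C <= gain p b%:C)%E.

Definition min_real_breakaway p b : Prop :=
  standard_real_breakaway p b /\
  \forall x \near b, (gain p b%:C <= gain p x%:C)%E.

(* [0 < z] in R[i] means that z is real and positive. *)
Definition locus_2qpi p (J : set R) : Prop :=
  forall x, J x -> 0 < PP p x%:C.

End RootLocus.

Section Classes.
Variable R : realType.
Implicit Types (p : {poly R}) (x b z : R).

Definition Lambda1 : set {poly R} := [set p | exists x, root p x].
Definition Lambda2 : set {poly R} := [set p | ~ exists x, root p x].

Definition Lambda21 : set {poly R} :=
  [set p | [/\ Lambda2 p, (3%:E <= sharp_r p^`())%E
    & (exists2 x, root p^`() x & (1 < \mu_x p^`())%N) ->
      exists x y, [/\ x != y, root p^`() x & root p^`() y]]].

Definition Lambda22 : set {poly R} :=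
  [set p | Lambda2 p /\
    exists x, (forall y, root p^`() y <-> y = x) /\ (1 < \mu_x p^`())%N].

Definition Gamma : set {poly R} :=
  [set p | Lambda2 p /\
    exists x, (forall y, root p^`() y <-> y = x) /\ \mu_x p^`() = 1%N].

(* The unique real zero of p' when p is in Gamma. *)
Definition p0 p : R := head 0 (rootsR p^`()).

Definition Gamma1 : set {poly R} :=
  [set p | Gamma p /\ ~ exists x, root p^`(2) x].
Definition Gamma2 : set {poly R} :=
  [set p | Gamma p /\ exists x, root p^`(2) x].

Definition Gamma12 : set {poly R} :=
  [set p | Gamma1 p /\ exists b, standard_real_breakaway p b].
Definition Gamma122 : set {poly R} :=
  [set p | Gamma12 p /\
    exists2 b, max_real_breakaway p b & (K0 p <= gain p b%:C)%E].

Definition zero_right p z : Prop := root p^`(2) z /\ p0 p < z.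
Definition zero_left p z : Prop := root p^`(2) z /\ z < p0 p.

Definition Gamma21 : set {poly R} :=
  [set p | [/\ Gamma2 p, exists z, zero_right p z & ~ exists z, zero_left p z]].
Definition Gamma22 : set {poly R} :=
  [set p | [/\ Gamma2 p, exists z, zero_left p z & ~ exists z, zero_right p z]].
Definition Gamma23 : set {poly R} :=
  [set p | [/\ Gamma2 p, exists z, zero_right p z & exists z, zero_left p z]].

Definition right_infinite_interval p (J : set R) : Prop :=
  exists zm, [/\ zero_right p zm, forall z, zero_right p z -> z <= zm
    & J = `]zm, +oo[%classic].

Definition left_infinite_interval_2qpi p (J : set R) : Prop :=
  exists zs, [/\ zero_left p zs, forall z, zero_left p z -> zs <= z,
    J = `]-oo, zs[%classic & locus_2qpi p J].

Definition finite_interval_2qpi p (side : R -> Prop) (J : set R) : Prop :=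
  exists z1 z2,
    [/\ [/\ side z1, side z2 & z1 < z2],
        forall z, z1 < z < z2 -> ~~ root p^`(2) z,
        J = `]z1, z2[%classic & locus_2qpi p J].

Definition has_low_min_breakaway p (J : set R) : Prop :=
  exists b, [/\ J b, min_real_breakaway p b & (gain p b%:C <= K0 p)%E].

Definition Gamma211 : set {poly R} :=
  [set p | Gamma21 p /\ ~~ odd (nb_zeros_right p^`(2) (p0 p))].
Definition Gamma212 : set {poly R} :=
  [set p | Gamma21 p /\ odd (nb_zeros_right p^`(2) (p0 p))].
Definition Gamma2122 : set {poly R} :=
  [set p | Gamma212 p /\
    exists2 J, right_infinite_interval p J \/
               finite_interval_2qpi p (zero_right p) J
             & has_low_min_breakaway p J].

Definition Gamma231 : set {poly R} :=
  [set p | Gamma23 p /\ ~~ odd (nb_zeros_right p^`(2) (p0 p))].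
Definition Gamma232 : set {poly R} :=
  [set p | Gamma23 p /\ odd (nb_zeros_right p^`(2) (p0 p))].
Definition Gamma2322 : set {poly R} :=
  [set p | Gamma232 p /\
    exists2 J, [\/ right_infinite_interval p J,
                   finite_interval_2qpi p (zero_right p) J,
                   left_infinite_interval_2qpi p J
                 | finite_interval_2qpi p (zero_left p) J]
             & has_low_min_breakaway p J].

End Classes.

(* Main.v *)
(* With K = p'^2 / (p p''), a real zero of q = (n-1) p'^2 - n p p'' is a point
   where K = n/(n-1), the limit of K at infinity. If p has no real zero, then
   q <= 0 at the global minimum of |p| while q >= 0 at every real zero of p'', so
   q has a real zero as soon as p'' has one; this settles every class but Gamma1.
   The classes Gamma212 and Gamma232 are empty, since p'' has the same sign at p0
   and at +oo.
   In Gamma1, K is finite on the whole real line and vanishes at p0, and a real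
   zero of q amounts to a global maximum b of K with K(b) >= n/(n-1). That b is
   then a breakaway point requires global root loci through b. They come from a
   selection theorem: the roots of a monic pencil A + t B can be followed
   continuously in t. Following nearest roots along a mesh of step 1/m gives
   chains that are equicontinuous uniformly in m, because a chain staying e-close
   to at most d points with steps at most e moves by at most 3 d e; an ultrafilter
   limit in m is a continuous root. *)

Require Import Defs.
From mathcomp Require Import all_boot all_order all_algebra.
From mathcomp Require Import all_classical all_reals all_analysis.
From mathcomp Require Import polyorder polyrcf complex.
From mathcomp Require Import lra ring zify.
Import Order.TTheory GRing.Theory Num.Theory.
Import numFieldNormedType.Exports.
Import ComplexField.

Set Implicit Arguments.
Unset Strict Implicit.
Unset Printing Implicit Defensive.

Local Open Scope classical_set_scope.
Local Open Scope ring_scope.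
Local Open Scope complex_scope.

(** * Root estimates *)

(** A branch may run through multiple solutions of [k N = D], where the implicit function theorem
    stops. A root selection needs no simplicity, but it does not let one choose which root is
    followed after a collision. Hence the passage at [b] is imposed: the arrivals on both sides of
    [b] are inverses of [K] on monotone real arcs, and the selection only supplies what precedes and
    follows them. The two loci separate past [b] because [K b] is the global maximum: no solution of
    larger gain is real, so an outgoing branch never meets its conjugate. A second obstacle is that
    [k N - D] may lose degree for some [k], so that a root escapes to infinity; the pencil is made
    monic by sending a zero of [D] (or of [N], for incoming branches) to infinity instead. *)

Section ComplexNorm.
Variable R : realType.
Implicit Types (x y z : R[i]) (r : R).

Definition cnorm z : R := complex.Re `|z|.

Lemma cnormE z : `|z| = (cnorm z)%:C.
Proof. by rewrite /cnorm [LHS]complexE ger0_Im// mulr0 addr0. Qed.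

Lemma cnorm_ge0 z : 0 <= cnorm z.
Proof. by rewrite -ler0c -cnormE. Qed.

Lemma cnorm0 : cnorm 0 = 0.
Proof. by rewrite /cnorm normr0. Qed.

Lemma cnormM x y : cnorm (x * y) = cnorm x * cnorm y.
Proof. by apply: complexI; rewrite rmorphM/= -!cnormE normrM. Qed.

Lemma cnormX x n : cnorm (x ^+ n) = cnorm x ^+ n.
Proof. by apply: complexI; rewrite rmorphXn/= -!cnormE normrX. Qed.

Lemma cnormV x : cnorm x^-1 = (cnorm x)^-1.
Proof. by apply: complexI; rewrite fmorphV/= -!cnormE normfV. Qed.

Lemma cnormD x y : cnorm (x + y) <= cnorm x + cnorm y.
Proof. by rewrite -lecR rmorphD/= -!cnormE ler_normD. Qed.

Lemma cnormN x : cnorm (- x) = cnorm x.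
Proof. by rewrite /cnorm normrN. Qed.

Lemma cnormC x y : cnorm (x - y) = cnorm (y - x).
Proof. by rewrite /cnorm distrC. Qed.

Lemma cnorm_eq0 x : (cnorm x == 0) = (x == 0).
Proof.
by rewrite -(normr_eq0 x) cnormE -(rmorph0 (real_complex R))
  (inj_eq (@complexI R)).
Qed.

Lemma cnormR r : cnorm r%:C = `|r|.
Proof. by rewrite /cnorm normc_def/= expr0n addr0 sqrtr_sqr. Qed.

Lemma cnorm_triangle x y z : cnorm (x - z) <= cnorm (x - y) + cnorm (y - z).
Proof. by rewrite -[x - z](subrKA y) cnormD. Qed.

Lemma cnorm_sum (I : Type) (s : seq I) (P : pred I) (F : I -> R[i]) :
  cnorm (\sum_(i <- s | P i) F i) <= \sum_(i <- s | P i) cnorm (F i).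
Proof.
apply: (big_ind2 (fun a b => cnorm a <= b)) => //; first by rewrite cnorm0.
by move=> a b c d ab cd; rewrite (le_trans (cnormD _ _))// lerD.
Qed.

Lemma cnorm_conj z : cnorm z^*%C = cnorm z.
Proof. by rewrite /cnorm normcJ. Qed.

Lemma cnorm_le_ReIm z : cnorm z <= `|complex.Re z| + `|complex.Im z|.
Proof.
rewrite {1}[z]complexE (le_trans (cnormD _ _))// cnormM !cnormR.
rewrite (_ : cnorm 'i = 1) ?mul1r//.
by rewrite /cnorm normc_def/= expr0n add0r expr1n sqrtr1.
Qed.

Lemma Re_le_cnorm z : `|complex.Re z| <= cnorm z.
Proof. by rewrite -lecR -cnormE normc_ge_Re. Qed.

Lemma Im_le_cnorm z : `|complex.Im z| <= cnorm z.
Proof.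
have := Re_le_cnorm (z * 'i); rewrite ReiNIm normrN cnormM.
rewrite (_ : cnorm 'i = 1) ?mulr1//.
by rewrite /cnorm normc_def/= expr0n add0r expr1n sqrtr1.
Qed.

End ComplexNorm.

Section RootEstimates.
Variable R : realType.
Local Notation C := R[i].
Implicit Types (P Q : {poly C}) (z w : C).

Lemma monic_factors P : P \is monic ->
  exists rs : seq C, size rs = (size P).-1 /\ P = \prod_(r <- rs) ('X - r%:P).
Proof.
move=> Pm; have [rs Prs] := closed_field_poly_normal P.
have e : P = \prod_(r <- rs) ('X - r%:P).
  by rewrite {1}Prs (monicP Pm) scale1r.
by exists rs; split=> //; rewrite e size_prod_XsubC.
Qed.

(** [cnorm P.[z]] is the product of the distances from [z] to the roots, and none of them is smaller
    than the distance to the nearest root. *)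
Lemma root_near P z : P \is monic -> (1 < size P)%N ->
  exists2 r, root P r & cnorm (z - r) ^+ (size P).-1 <= cnorm P.[z].
Proof.
move=> Pm P1; have [rs [rsz Prs]] := monic_factors Pm; rewrite -rsz.
have {P1} : (0 < size rs)%N by rewrite rsz; case: (size P) P1 => [|[]].
rewrite {}Prs {Pm} in rsz *.
have -> : cnorm (\prod_(r <- rs) ('X - r%:P)).[z] = \prod_(r <- rs) cnorm (z - r).
  rewrite horner_prod; under eq_bigr do rewrite hornerXsubC.
  by apply: (big_morph _ (@cnormM R)); rewrite /cnorm normr1.
move=> rs0; have: exists2 r, r \in rs & forall s, s \in rs -> cnorm (z - r) <= cnorm (z - s).
  elim: rs rs0 {rsz} => // a s IH _; case: (posnP (size s)) => [/size0nil->|/IH[r rin rle]].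
    by exists a; rewrite ?mem_head// => x; rewrite inE => /eqP->.
  have [lar|lra] := leP (cnorm (z - a)) (cnorm (z - r)).
    exists a; rewrite ?mem_head// => x; rewrite inE => /orP[/eqP->//|/rle].
    exact: le_trans.
  exists r; rewrite ?inE ?rin ?orbT// => x; rewrite inE => /orP[/eqP->|/rle//].
  exact: ltW.
move=> [r rin rle]; exists r; first by rewrite root_prod_XsubC.
elim: rs rle {rin rsz rs0} => [|a s IH] rle; first by rewrite big_nil expr0.
rewrite /= exprS big_cons ler_pM ?cnorm_ge0 ?exprn_ge0 ?cnorm_ge0//.
  by rewrite rle// mem_head.
by apply: IH => x xin; rewrite rle// inE xin orbT.
Qed.

(** If [cnorm w > 1], isolating the leading term gives [cnorm w ^ d <= S * cnorm w ^ (d - 1)] with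
    [d] the degree; the summand 1 covers the unit disc. *)
Lemma root_bound P w : P \is monic -> root P w ->
  cnorm w <= 1 + \sum_(i < (size P).-1) cnorm P`_i.
Proof.
move=> Pm Pw; set S := \sum_(i < _) _.
have S0 : 0 <= S by apply: sumr_ge0 => i _; exact: cnorm_ge0.
have [w1|w1] := leP (cnorm w) 1; first by rewrite (le_trans w1) ?lerDl.
have d0 : (0 < (size P).-1)%N.
  case: (size P) (@root_size_gt1 _ _ _ (monic_neq0 Pm) Pw) => [|[]]//.
suff : cnorm w <= S by move=> wS; rewrite (le_trans wS)// lerDr.
move: Pw; rewrite /root horner_coef.
have -> : size P = (size P).-1.+1 by rewrite prednK// size_poly_gt0 monic_neq0.
rewrite big_ord_recr/= -[P`__]/(lead_coef P) (monicP Pm) mul1r addrC addr_eq0 => /eqP we.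
have : cnorm w ^+ (size P).-1 <= S * cnorm w ^+ (size P).-2.
  rewrite -cnormX we cnormN (le_trans (cnorm_sum _ _ _))// mulr_suml.
  apply: ler_sum => i _; rewrite cnormM ler_wpM2l ?cnorm_ge0// cnormX.
  by rewrite ler_weXn2l ?(ltW w1)// -ltnS prednK.
rewrite -[in leLHS](prednK d0) exprSr mulrC ler_pM2r// exprn_gt0//.
exact: lt_trans w1.
Qed.

Lemma horner_bound P M : exists2 B, 0 < B &
  forall w, cnorm w <= M -> cnorm P.[w] <= B.
Proof.
have M0 : 0 <= Num.max 0 M by rewrite le_max lexx.
exists (1 + \sum_(i < size P) cnorm P`_i * Num.max 0 M ^+ i).
  rewrite ltr_wpDr// sumr_ge0// => i _; rewrite mulr_ge0 ?cnorm_ge0//.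
  by rewrite exprn_ge0.
move=> w wM; rewrite horner_coef (le_trans (cnorm_sum _ _ _))// -[leLHS]add0r.
rewrite lerD// ler_sum// => i _; rewrite cnormM cnormX ler_wpM2l ?cnorm_ge0//.
by rewrite lerXn2r ?nnegrE ?cnorm_ge0// le_max wM orbT.
Qed.

(** Dividing [P - P.[z]] by ['X - z] gives a Lipschitz estimate on the disc of radius 1 around
    [z]. *)
Lemma horner_cont P z e : 0 < e ->
  exists2 d, 0 < d & forall w, cnorm (w - z) < d -> cnorm (P.[w] - P.[z]) < e.
Proof.
move=> e0; have [Q PQ] : exists Q, P - P.[z]%:P = Q * ('X - z%:P).
  by apply/factor_theorem; rewrite /root !hornerE subrr.
have [B B0 QB] := horner_bound Q (cnorm z + 1).
exists (Num.min 1 (e / B)); first by rewrite lt_min ltr01 divr_gt0.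
move=> w; rewrite lt_min => /andP[w1 wB].
have := congr1 (horner^~ w) PQ.
rewrite /= hornerD hornerN hornerC hornerM hornerXsubC => ->.
rewrite cnormM (@le_lt_trans _ _ (B * cnorm (w - z)))//; last by rewrite mulrC -ltr_pdivlMr.
rewrite ler_wpM2r ?cnorm_ge0// QB// -[w](subrK z) addrC (le_trans (cnormD _ _))//.
by rewrite lerD2l ltW.
Qed.

(* The points [u l] stay within [e] of finitely many centers [rs] and move by
   steps of at most [e]; erasing the loops of the itinerary through the centers
   bounds the total displacement. *)
Lemma chain_displacement (rs : seq C) (e : R) (u : nat -> C) (i j : nat) :
  (i <= j)%N ->
  (forall l, (i <= l <= j)%N -> exists2 r, r \in rs & cnorm (u l - r) <= e) ->
  (forall l, (i <= l < j)%N -> cnorm (u l.+1 - u l) <= e) ->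
  cnorm (u j - u i) <= (3 * size rs)%:R * e.
Proof.
move=> ij near step.
(* Centers of consecutive points are at most [3 * e] apart: [e] from the first center to its point,
   [e] for the step, [e] to the next center. *)
pose E := [rel x y : C | cnorm (x - y) <= 3 * e].
have [ri ri_in nri] := near i (introT andP (conj (leqnn i) ij)).
have e0 : 0 <= e by rewrite (le_trans (cnorm_ge0 _) nri).
have : exists p, [/\ path E ri p, all (mem rs) p & cnorm (u j - last ri p) <= e].
  elim: j ij near step => [|j IH] ij near step.
    by exists [::]; move: ij nri; rewrite leqn0 => /eqP->.
  move: ij; rewrite leq_eqVlt => /orP[/eqP <-|]; first by exists [::].
  rewrite ltnS => ij; have [|l Hl|p [pE prs pl]] := IH ij.
  - move=> l /andP[il lj]; apply: near; rewrite il; exact: leqW.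
  - by apply: step; case/andP: Hl => -> /ltnW; rewrite ltnS.
  have [r rin rle] := near j.+1 ltac:(by rewrite leqnn (leqW ij)).
  exists (rcons p r); split; rewrite ?last_rcons//.
    rewrite rcons_path pE/= (le_trans (cnorm_triangle _ (u j.+1) _))//.
    rewrite (_ : 3 * e = (e + e) + e); last by lra.
    rewrite lerD// (le_trans (cnorm_triangle _ (u j) _))// lerD//.
      by rewrite cnormC.
    by rewrite cnormC step// ij ltnSn.
  by rewrite all_rcons prs andbT; exact: rin.
(* The bound must not depend on [j - i]. A path without repetition has at most [size rs - 1] edges
   of length [3 * e], and the two end pieces add [2 * e]. *)
move=> [p [pE prs pl]]; case/shortenP: pE pl => p' p'E p'u p'p pl.
have len : (size (ri :: p') <= size rs)%N.
  apply: uniq_leq_size p'u _ => x; rewrite inE => /orP[/eqP->//|/p'p].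
  by move/(allP prs).
have dist : cnorm (last ri p' - ri) <= (size p')%:R * (3 * e).
  elim: p' (ri) p'E {p'u p'p pl len} => [|a p' IH] r /=.
    by rewrite subrr cnorm0 mul0r.
  move=> /andP[ra /IH{}IH]; rewrite (le_trans (cnorm_triangle _ a _))//.
  by rewrite -natr1 mulrDl mul1r lerD// cnormC.
rewrite (le_trans (cnorm_triangle _ (last ri p') _))//.
have : cnorm (last ri p' - u i) <= (size p')%:R * (3 * e) + e.
  by rewrite (le_trans (cnorm_triangle _ ri _))// lerD// cnormC.
have : ((size p')%:R + 1) * e <= (size rs)%:R * e.
  by rewrite ler_wpM2r// natr1 ler_nat.
rewrite natrM; move: pl; set a := cnorm _; set b := cnorm _; nra.
Qed.

End RootEstimates.

(** * Continuous selection of roots *)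

Section RootLifting.
Variable R : realType.
Local Notation C := R[i].

(** The image ultrafilter contains a compact segment, so it clusters there, and a cluster point of
    an ultrafilter is a limit. *)
Lemma ultra_limit (U : set_system nat) (u : nat -> R) (M : R) :
  UltraFilter U -> (forall m, `|u m| <= M) ->
  exists l, forall e, 0 < e -> U [set m | `|u m - l| < e].
Proof.
move=> UU uM.
have UM : (u @ U) `[- M, M]%classic.
  by apply: (@filterE _ U) => m; rewrite /= in_itv; move: (uM m); rewrite ler_norml.
have [l [_ ul]] := @segment_compact R (- M) M (u @ U) _ UM.
exists l => e e0; case: (in_ultra_setVsetC [set m | `|u m - l| < e] UU) => // Un.
have [x [/= xn xl]] := ul [set x | ~ `|x - l| < e] (ball l e) Un (nbhsx_ballx _ _ e0).
by case: xn; rewrite distrC.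
Qed.

Lemma ultra_climit (U : set_system nat) (u : nat -> C) (M : R) :
  UltraFilter U -> (forall m, cnorm (u m) <= M) ->
  exists l, forall e, 0 < e -> U [set m | cnorm (u m - l) < e].
Proof.
move=> UU uM.
have [a ua] := @ultra_limit U (fun m => complex.Re (u m)) M UU
  (fun m => le_trans (Re_le_cnorm _) (uM m)).
have [b ub] := @ultra_limit U (fun m => complex.Im (u m)) M UU
  (fun m => le_trans (Im_le_cnorm _) (uM m)).
exists (a +i* b) => e e0; have e2 : 0 < e / 2 by rewrite divr_gt0.
apply: filterS2 (ua _ e2) (ub _ e2) => m /= ma mb.
rewrite (le_lt_trans (cnorm_le_ReIm _))// (splitr e).
by move: ma mb; case: (u m) => x y /=; lra.
Qed.

Variables A B : {poly C}.
Hypotheses (Amonic : A \is monic) (sizeBA : (size B < size A)%N).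
Local Notation P t := (A + t%:C *: B).
Local Notation d := (size A).-1.

Let size_tB t : (size (t%:C *: B) < size A)%N.
Proof. exact: leq_ltn_trans (size_scale_leq _ _) sizeBA. Qed.

Lemma pencil_monic t : P t \is monic.
Proof. by rewrite monicE lead_coefDl ?(monicP Amonic). Qed.

Lemma pencil_size t : size (P t) = size A.
Proof. by rewrite size_polyDl. Qed.

Lemma pencil_root_bound : exists M, forall t w, 0 <= t <= 1 ->
  root (P t) w -> cnorm w <= M.
Proof.
exists (1 + \sum_(i < d) (cnorm A`_i + cnorm B`_i)) => t w /andP[t0 t1] Pw.
rewrite (le_trans (root_bound (pencil_monic t) Pw))// pencil_size lerD2l.
apply: ler_sum => i _; rewrite coefD coefZ (le_trans (cnormD _ _))// lerD2l.
by rewrite cnormM cnormR ger0_norm// ler_piMl// cnorm_ge0.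
Qed.

(** A root [w] of [P t] satisfies [(P t').[w] = (t' - t) * B.[w]], and [B] is bounded on a disc
    containing the roots for all [t] in [[0, 1]]. Through [root_near] this is a Hölder estimate of
    exponent [1 / d]. *)
Lemma pencil_root_near : exists2 K, 0 < K & forall t t' w,
  0 <= t <= 1 -> root (P t) w ->
  exists2 w', root (P t') w' & cnorm (w - w') ^+ d <= K * `|t - t'|.
Proof.
have [M PM] := pencil_root_bound; have [K K0 BK] := horner_bound B M.
exists K => // t t' w t01 Pw.
have Pt'1 : (1 < size (P t'))%N.
  by rewrite pencil_size -(pencil_size t) (root_size_gt1 _ Pw)// monic_neq0// pencil_monic.
have [w' Pw' ww'] := root_near w (pencil_monic t') Pt'1.
exists w' => //; move: ww'; rewrite pencil_size => /le_trans; apply.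
have -> : (P t').[w] = B.[w] * (t' - t)%:C.
  move: Pw; rewrite /root !hornerE => /eqP Pw.
  by rewrite rmorphB/= mulrBr [_ * t%:C]mulrC; apply/eqP; rewrite -subr_eq0 -Pw; apply/eqP; ring.
rewrite cnormM cnormR distrC ler_wpM2r// BK//; exact: PM Pw.
Qed.

(** The constant [K] is a parameter so that the chains of all meshes share it; equicontinuity rests
    on this. *)
Lemma pencil_chain (K : R) (w0 : C) (m : nat) :
  (forall t t' w, 0 <= t <= 1 -> root (P t) w ->
    exists2 w', root (P t') w' & cnorm (w - w') ^+ d <= K * `|t - t'|) ->
  root A w0 ->
  exists u : nat -> C, [/\ u 0%N = w0,
    forall j, (j <= m.+1)%N -> root (P (j%:R / m.+1%:R)) (u j)
    & forall j, (j < m.+1)%N -> cnorm (u j.+1 - u j) ^+ d <= K / m.+1%:R].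
Proof.
move=> near Aw0.
pose nxt (j : nat) (w : C) := xget w
  [set w' | root (P (j.+1%:R / m.+1%:R)) w' /\
  cnorm (w - w') ^+ d <= K * `|j%:R / m.+1%:R - j.+1%:R / m.+1%:R|].
pose fix u (j : nat) : C := if j is i.+1 then nxt i (u i) else w0.
have mesh j : (j <= m.+1)%N -> 0 <= (j%:R / m.+1%:R : R) <= 1.
  by move=> jm; rewrite divr_ge0//= ler_pdivrMr// mul1r ler_nat.
have nxtP j w : (j < m.+1)%N -> root (P (j%:R / m.+1%:R)) w ->
    root (P (j.+1%:R / m.+1%:R)) (nxt j w) /\
    cnorm (w - nxt j w) ^+ d <= K * `|j%:R / m.+1%:R - j.+1%:R / m.+1%:R|.
  move=> jm Pw; rewrite /nxt; case: xgetP => [x _ []//|].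
  have [w' w'1 w'2] := near _ (j.+1%:R / m.+1%:R) _ (mesh _ (ltnW jm)) Pw.
  by move=> /(_ w')[].
have uP j : (j <= m.+1)%N -> root (P (j%:R / m.+1%:R)) (u j).
  elim: j => [_|j IH jm]; first by rewrite mul0r scale0r addr0.
  by have [] := nxtP _ _ jm (IH (ltnW jm)).
exists u; split=> // j jm; rewrite cnormC.
have [_ /le_trans] := nxtP _ _ jm (uP _ (ltnW jm)); apply.
by rewrite distrC -mulrBl -natrB// subSnn mul1r ger0_norm.
Qed.

Lemma pencil_lift (w0 : C) : root A w0 ->
  exists w : R -> C, [/\ w 0 = w0,
    forall t, 0 <= t <= 1 -> root (P t) (w t)
    & forall e, 0 < e -> exists2 dl, 0 < dl & forall t t',
        0 <= t <= 1 -> 0 <= t' <= 1 -> `|t - t'| < dl -> cnorm (w t - w t') <= e].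
Proof.
move=> Aw0.
have [M PM] := pencil_root_bound; have [K K0 near] := pencil_root_near.
have [u uP] := choice (fun m => pencil_chain m near Aw0).
(* Index of the last mesh point that does not exceed [t]. *)
pose ix m t := Num.truncn (t * m.+1%:R : R).
have ixle m t : 0 <= t <= 1 -> (ix m t <= m.+1)%N.
  move=> /andP[t0 t1]; rewrite -ltnS -(ltr_nat R).
  have /andP[+ _] := truncn_itv (mulr_ge0 t0 (ler0n R m.+1)).
  move=> /le_lt_trans; apply; rewrite (@le_lt_trans _ _ m.+1%:R)// ?ltr_nat//.
  by rewrite ler_piMl.
have ixt m t : 0 <= t <= 1 -> `|t - (ix m t)%:R / m.+1%:R| <= m.+1%:R^-1.
  move=> /andP[t0 t1].
  have /andP[l r] := truncn_itv (mulr_ge0 t0 (ler0n R m.+1)).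
  rewrite ler_norml; apply/andP; split.
    by rewrite (@le_trans _ _ 0)// ?oppr_le0// subr_ge0 ler_pdivrMr.
  rewrite lerBlDl -[X in _ + X]mul1r -mulrDl ler_pdivlMr// natr1; exact: ltW.
have mesh j m : (j <= m.+1)%N -> 0 <= (j%:R / m.+1%:R : R) <= 1.
  by move=> jm; rewrite divr_ge0//= ler_pdivrMr// mul1r ler_nat.
(* One ultrafilter provides limits for all [t] at once, where subsequences would require a diagonal
   argument. *)
have [U [UU eU]] := @ultraFilterLemma nat \oo _.
(* Capping the index by [minn] makes the bound hold for every real [t], as [choice] requires; on
   [[0, 1]] the cap has no effect. *)
have wM m t : cnorm (u m (minn m.+1 (ix m t))) <= M.
  have [_ r _] := uP m; have h : (minn m.+1 (ix m t) <= m.+1)%N by rewrite geq_minl.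
  exact: PM (mesh _ _ h) (r _ h).
have [w wP] := choice (fun t => ultra_climit UU (wM ^~ t)).
have {}wP t e : 0 <= t <= 1 -> 0 < e -> U [set m | cnorm (u m (ix m t) - w t) < e].
  move=> t01 e0; apply: filterS (wP t e e0) => m /=; by rewrite (minn_idPr (ixle m t t01)).
have mU (e : R) : 0 < e -> U [set m | m.+1%:R^-1 < e].
  by move=> e0; apply: eU; have := near_infty_natSinv_lt (PosNum e0).
have d0 : (0 < d)%N.
  case: (size A) (root_size_gt1 (monic_neq0 Amonic) Aw0) => [|[]]//.
exists w; split.
- have e01 : 0 <= (0 : R) <= 1 by rewrite lexx ler01.
  apply/eqP; rewrite -subr_eq0 -cnorm_eq0; apply/eqP/le_anti; rewrite cnorm_ge0 andbT.
  apply/ler_addgt0Pr => e e0; rewrite add0r.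
  have [m /=] := filter_ex (wP 0 e e01 e0).
  by rewrite /ix mul0r truncn0 cnormC; case: (uP m) => -> _ _ /ltW.
- move=> t t01; rewrite /root -cnorm_eq0; apply/eqP/le_anti; rewrite cnorm_ge0 andbT.
  apply/ler_addgt0Pr => e e0; rewrite add0r.
  have e2 : 0 < e / 2 by rewrite divr_gt0.
  have [K' K'0 BK'] := horner_bound B M.
  have [dl dl0 cont] := horner_cont (P t) (w t) e2.
  have [m /= []] := filter_ex (filterI (wP t dl t01 dl0) (mU _ (divr_gt0 e2 K'0))).
  move=> /cont h hm; have [_ r _] := uP m; have := r _ (ixle m t t01) => rm.
  (* The point is a root at the mesh parameter, so its value under [P t] is [B] times the rounding
     error of [t]. *)
  have : cnorm (P t).[u m (ix m t)] <= e / 2.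
    have -> : (P t).[u m (ix m t)] =
        B.[u m (ix m t)] * (t - (ix m t)%:R / m.+1%:R)%:C.
      move: rm; rewrite /root !hornerE => /eqP rm.
      rewrite rmorphB/= mulrBr [_ * t%:C]mulrC; apply/eqP; rewrite -subr_eq0 -rm.
      by apply/eqP; ring.
    rewrite cnormM cnormR (@le_trans _ _ (K' * m.+1%:R^-1))//.
      by rewrite ler_pM ?cnorm_ge0 ?ixt// BK'// (PM _ _ _ rm)// mesh// ixle.
    by rewrite mulrC -ler_pdivlMr// ltW.
  rewrite [X in _ -> _ <= X](splitr e) => h'.
  rewrite -[X in cnorm X](subKr (P t).[u m (ix m t)]) (le_trans (cnormD _ _))//.
  by rewrite lerD// cnormN ltW.
(* The centers are the [d] roots at the mesh point of [t], so the chain moves by at most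
   [3 * d * e1 = e / 2]; passing to the limit at [t] and at [t'] costs [e / 4] each. *)
- move=> e e0; pose e1 := e / 2 / (3 * d)%:R.
  have d3 : 0 < (3 * d)%:R :> R by rewrite ltr0n muln_gt0.
  have e10 : 0 < e1 by rewrite !divr_gt0.
  (* Mesh points between those of [t] and [t'] differ by at most [3 * dl]: [dl] for [t' - t] and
     [dl] for each rounding. Since [K * (3 * dl) = e1 ^ d], their roots are [e1]-close. *)
  pose dl := e1 ^+ d / K / 3.
  have dl0 : 0 < dl by rewrite !divr_gt0 ?exprn_gt0.
  exists dl => // t t' t01 t'01 tt'.
  wlog le_ix : t t' t01 t'01 tt' / t <= t'.
    move=> H; have [|/ltW] := leP t t'; first exact: H.
    by rewrite cnormC; apply: H => //; rewrite distrC.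
  have e4 : 0 < e / 4 by rewrite divr_gt0.
  have [m /= [[ht ht'] hm]] := filter_ex
    (filterI (filterI (wP t _ t01 e4) (wP t' _ t'01 e4)) (mU _ dl0)).
  have [_ r s] := uP m.
  have [rs [rsz rsE]] := monic_factors (pencil_monic ((ix m t)%:R / m.+1%:R)).
  have bnd x y : 0 <= y -> x ^+ d <= K * y -> y <= 3 * dl -> 0 <= x -> x <= e1.
    move=> y0 xy ydl x0; rewrite -(@ler_pXn2r _ d)// ?nnegrE ?(ltW e10)//.
    rewrite (le_trans xy)// -ler_pdivlMl// mulrC (le_trans ydl)// /dl; lra.
  have ixx : (ix m t <= ix m t')%N.
    by rewrite /ix le_truncn// ler_wpM2r.
  have := @chain_displacement R rs e1 (u m) (ix m t) (ix m t') ixx _ _.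
  have -> : (3 * size rs)%:R * e1 = e / 2.
    by rewrite rsz pencil_size /e1 mulrC divfK// gt_eqF.
  have ixtt : (ix m t')%:R / m.+1%:R - (ix m t)%:R / m.+1%:R <= 3 * dl.
    have := ixt m t t01; have := ixt m t' t'01.
    move: tt' hm; rewrite !ler_norml ltr_norml.
    set a := _ / _; set b := _ / _; set c := _^-1; lra.
  move=> H; have {H} : cnorm (u m (ix m t') - u m (ix m t)) <= e / 2.
    apply: H => l /andP[l1 l2].
      have lm : (l <= m.+1)%N by rewrite (leq_trans l2)// ixle.
      have [w' w'r w'n] := near _ ((ix m t)%:R / m.+1%:R) _ (mesh _ _ lm) (r _ lm).
      exists w'; first by rewrite -root_prod_XsubC -rsE.
      apply: bnd w'n _ _; rewrite ?cnorm_ge0//.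
      rewrite -mulrBl -natrB// ger0_norm; last by rewrite divr_ge0.
      rewrite (le_trans _ ixtt)// -mulrBl -natrB// ler_wpM2r// ler_nat.
      exact: leq_sub2r.
    have lm : (l < m.+1)%N by rewrite (leq_trans l2)// ixle.
    apply: bnd (s _ lm) _ _ => //; last exact: cnorm_ge0.
    by rewrite (le_trans (ltW hm))// ler_peMl// ?ltW// ltr1n.
  rewrite [X in _ -> _ <= X](_ : _ = e / 4 + (e / 2 + e / 4)); last by lra.
  move=> h; rewrite (le_trans (cnorm_triangle _ (u m (ix m t)) _))// lerD//.
    by rewrite cnormC ltW.
  rewrite (le_trans (cnorm_triangle _ (u m (ix m t')) _))// lerD//; first by rewrite cnormC.
  exact: ltW.
Qed.

End RootLifting.

(** * Branches of k N = D *)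

Section Branches.
Variable R : realType.
Local Notation C := (R[i]^o).
Implicit Types (N D P : {poly R[i]}) (c : R[i]).

(** Radii of balls in [C] are elements of [R[i]]; a positive one is real, so real radii suffice. *)
Lemma cvg_cnormP (T : Type) (F : set_system T) (f : T -> C) (z : C) :
  Filter F ->
  f @ F --> z <-> forall e : R, 0 < e -> \forall x \near F, cnorm (z - f x) < e.
Proof.
move=> FF; split=> [/cvgrPdist_lt fz e e0|fz].
  have /fz : (0 : R[i]) < e%:C by rewrite ltcR.
  by apply: filterS => x; rewrite cnormE ltcR.
apply/cvgrPdist_lt => e; rewrite ltcE => /andP[/eqP eI eR].
apply: filterS (fz _ eR) => x xe; rewrite cnormE.
by rewrite [e]complexE eI mulr0 addr0 ltcR.
Qed.

Lemma cvg_cnorm (T : Type) (F : set_system T) (f : T -> C) (z : C) :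
  Filter F -> f @ F --> z -> cnorm (f x) @[x --> F] --> cnorm z.
Proof.
move=> FF /cvg_cnormP fz; apply/cvgrPdist_lt => e e0.
apply: filterS (fz e e0) => x; apply: le_lt_trans.
have := cnorm_triangle z (f x) 0; have := cnorm_triangle (f x) z 0.
by rewrite !subr0 (cnormC (f x)) ler_norml; lra.
Qed.

(** The projection onto [[a, b]]: composing with it extends a continuous function on the segment to
    the whole line by constants. *)
Definition clamp (a b t : R) := Num.max a (Num.min b t).

Lemma clamp_continuous a b : continuous (clamp a b).
Proof.
move=> t; rewrite /clamp; apply: continuous_max; first exact: cvg_cst.
by apply: continuous_min; [exact: cvg_cst|exact: cvg_id].
Qed.

Lemma clamp_itv a b t : a <= b -> a <= clamp a b t <= b.
Proof. by move=> ab; rewrite /clamp le_max lexx/= ge_max ab ge_min lexx. Qed.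

Lemma clamp_id a b t : a <= t <= b -> clamp a b t = t.
Proof. by move=> /andP[at_ tb]; rewrite /clamp (min_idPr tb) (max_idPr at_). Qed.

Lemma clamp_le a b t : t <= a -> a <= b -> clamp a b t = a.
Proof. by move=> ta ab; rewrite /clamp (min_idPr (le_trans ta ab)) (max_idPl ta). Qed.

Lemma clamp_ge a b t : b <= t -> a <= b -> clamp a b t = b.
Proof. by move=> bt ab; rewrite /clamp (min_idPl bt) (max_idPr ab). Qed.

Lemma pencil_lift_continuous (A B : {poly R[i]}) (w0 : R[i]) :
  A \is monic -> (size B < size A)%N -> root A w0 ->
  exists w : R -> C, [/\ continuous w, w 0 = w0
    & forall t, 0 <= t <= 1 -> root (A + t%:C *: B) (w t)].
Proof.
move=> Am BA /(pencil_lift Am BA)[w [w0E wroot wc]].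
exists (w \o clamp 0 1); split.
- move=> t; apply/cvg_cnormP => e e0.
  have [d d0 wd] := wc _ (divr_gt0 e0 (ltr0n R 2)).
  have /cvgrPdist_lt/(_ d d0) := @clamp_continuous 0 1 t.
  apply: filterS => t' /wd /= h; rewrite (le_lt_trans (h _ _)) ?clamp_itv//.
  by rewrite ltr_pdivrMr// ltr_pMr// ltr1n.
- by rewrite /= clamp_id// lexx ler01.
- by move=> t t01 /=; rewrite clamp_id// wroot.
Qed.

(** The infimum of a nonempty zero set is a zero by continuity. Applied to the norm of the
    coordinate [w], it gives the first passage through infinity, or [T = 1] if there is none. *)
Lemma first_zero (f : R -> R) : continuous f -> f 0 != 0 ->
  exists T, [/\ 0 < T <= 1, forall t, 0 <= t < T -> f t != 0 & f T = 0 \/ T = 1].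
Proof.
move=> fc f0; pose Z := [set t | 0 <= t <= 1 /\ f t = 0].
have [Z0|nZ] := pselect (Z !=set0); last first.
  exists 1; split; [by rewrite ltr01 lexx| |by right].
  move=> t /andP[t0 t1]; apply/eqP => ft; apply: nZ; exists t; split=> //.
  by rewrite t0 ltW.
have Zlb : has_lbound Z by exists 0 => t [/andP[]].
have Zi : has_inf Z by split.
set T := inf Z.
have T0 : 0 <= T by apply: lb_le_inf => // t [/andP[]].
have T1 : T <= 1.
  by have [t Zt] := Z0; rewrite (le_trans (ge_inf Zlb Zt))//; case: Zt => /andP[].
have fT : f T = 0.
  apply/eqP; apply: contrapT => /negP fT.
  have fT0 : 0 < `|f T| by rewrite normr_gt0.
  have /cvgrPdist_lt/(_ _ fT0)/nbhs_ballP[d /= d0 fd] := fc T.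
  have [t Zt tT] := inf_adherent d0 Zi.
  have Tt : T <= t := ge_inf Zlb Zt.
  have := fd t; rewrite /ball/= distrC ger0_norm ?subr_ge0// ltrBlDl.
  by move=> /(_ tT); case: Zt => _ ->; rewrite subr0 ltxx.
exists T; split; last by left.
- by rewrite lt_def T0 T1 !andbT; apply: contra f0 => /eqP T00; rewrite -[X in f X]T00 fT.
- move=> t /andP[t0 tT]; apply/eqP => ft; move: (tT); rewrite ltNge ge_inf//.
  by split=> //; rewrite t0 (le_trans (ltW tT)).
Qed.

(* [P] written in the coordinate [w = 1 / (s - c)] and homogenized in degree [d]:
   the point at infinity of the [s]-sphere becomes [w = 0]. *)
Definition reversal (d : nat) c P :=
  \poly_(i < d.+1) (P \Po ('X + c%:P))`_(d - i).

Lemma reversal_size d c P : (size (reversal d c P) <= d.+1)%N.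
Proof. exact: size_poly. Qed.

Lemma reversal_lead d c P : (reversal d c P)`_d = P.[c].
Proof.
by rewrite coef_poly ltnSn subnn -horner_coef0 horner_comp !hornerE.
Qed.

Lemma horner_reversal d c P w : (size P <= d.+1)%N -> w != 0 ->
  (reversal d c P).[w] = w ^+ d * P.[c + w^-1].
Proof.
move=> Pd w0; rewrite horner_poly.
have -> : P.[c + w^-1] = (P \Po ('X + c%:P)).[w^-1].
  by rewrite horner_comp !hornerE addrC.
have Pd' : (size (P \Po ('X + c%:P)) <= d.+1)%N.
  by rewrite size_comp_poly2 ?size_XaddC.
rewrite (horner_coef_wide _ Pd') mulr_sumr (reindex_inj rev_ord_inj).
apply: eq_bigr => i _ /=; rewrite subSS subKn -1?ltnS// mulrCA; congr (_ * _).
by rewrite exprVn expfB_cond// (negbTE w0) add0n -ltnS.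
Qed.

(* [h] is constant below [k0], so that arcs will be glued by adding them. Up to a
   factor [k N - D] is the pencil [(k0 N - D) + t D] with [t = 1 - k0 / k]; as
   [D.[c] = 0], its reversal at [c] has the constant leading coefficient
   [k0 N.[c]]. The branch is cut at the first [t] where it reaches infinity. *)
Lemma branch_out N D c (k0 : R) (s0 : R[i]) :
  0 < k0 -> root D c -> (forall s, root N s -> root D s -> False) ->
  k0%:C * N.[s0] = D.[s0] ->
  exists (k1 : \bar R) (h : R -> C),
  [/\ (k0%:E < k1)%E, forall k, k <= k0 -> h k = s0,
      forall k, (k%:E < k1)%E -> {for k, continuous h},
      forall k, k0 <= k -> (k%:E < k1)%E -> k%:C * N.[h k] = D.[h k]
    & (exists2 s, root N s & h k @[k --> end_filter k1] --> (s : C)) \/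
      cnorm (h k) @[k --> end_filter k1] --> +oo%R].
Proof.
move=> k00 Dc NDco s0E.
have k0C : k0%:C != 0 :> R[i].
  by rewrite -(rmorph0 (real_complex R)) (inj_eq (@complexI R)) gt_eqF.
have Nc : N.[c] != 0 by apply/negP => Nc; exact: NDco Nc Dc.
pose u := k0%:C * N.[c]; have u0 : u != 0 by rewrite mulf_neq0.
pose d := maxn (size N) (size D).
have szN : (size N <= d.+1)%N by rewrite leqW// leq_maxl.
have szD : (size D <= d.+1)%N by rewrite leqW// leq_maxr.
pose F := k0%:C *: N - D.
have szF : (size F <= d.+1)%N.
  rewrite (leq_trans (size_polyD _ _))// geq_max size_polyN szD andbT.
  by rewrite (leq_trans (size_scale_leq _ _)).
pose A := u^-1 *: reversal d c F; pose B := u^-1 *: reversal d c D.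
have Ad : A`_d = 1.
  by rewrite coefZ reversal_lead !hornerE (eqP Dc) oppr0 addr0 mulVf.
have szA : size A = d.+1.
  apply/anti_leq; rewrite (leq_trans (size_scale_leq _ _)) ?reversal_size//=.
  rewrite ltnNge; apply/negP => /(nth_default 0) A0; move: Ad; rewrite A0 => /eqP.
  by rewrite eq_sym oner_eq0.
have Am : A \is monic by rewrite monicE /lead_coef szA Ad.
have szB : (size B < size A)%N.
  rewrite szA ltnS; apply/leq_sizeP => j; rewrite leq_eqVlt => /orP[/eqP <-|dj].
    by rewrite coefZ reversal_lead (eqP Dc) mulr0.
  by rewrite coefZ nth_default ?mulr0// (leq_trans (reversal_size _ _ _)).
have s0c : s0 - c != 0.
  rewrite subr_eq0; apply/eqP => s0c; move: s0E; rewrite s0c (eqP Dc) => /eqP.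
  by rewrite mulf_eq0 (negbTE k0C) (negbTE Nc).
have pencilE t w : w != 0 -> root (A + t%:C *: B) w ->
    k0%:C * N.[c + w^-1] = (1 - t)%:C * D.[c + w^-1].
  move=> w0; rewrite /root hornerD !hornerZ !horner_reversal// /F hornerD hornerN hornerZ.
  move=> /eqP e.
  have /eqP : u^-1 * w ^+ d * (k0%:C * N.[c + w^-1] - (1 - t)%:C * D.[c + w^-1]) = 0.
    by rewrite -e rmorphB/=; ring.
  rewrite mulf_eq0 mulf_eq0 invr_eq0 (negbTE u0) expf_eq0 (negbTE w0) andbF/=.
  by rewrite subr_eq0 => /eqP.
have Aw0 : root A (s0 - c)^-1.
  rewrite /root hornerZ horner_reversal ?invr_eq0// invrK [c + _]addrC subrK.
  by rewrite /F hornerD hornerN hornerZ s0E subrr !mulr0.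
have [w [wc w0E wroot]] := pencil_lift_continuous Am szB Aw0.
have nwc : continuous (fun t => cnorm (w t)) by move=> t; apply: cvg_cnorm; exact: wc.
have [|T [/andP[T0 T1] wT0 wT]] := first_zero nwc.
  by rewrite cnorm_eq0 w0E invr_eq0.
(* The maximum keeps [tt] continuous on the whole line and equal to 0 below [k0], which makes the
   branch constant there. *)
pose tt (k : R) := 1 - k0 / Num.max k0 k.
have maxk k : 0 < Num.max k0 k by rewrite lt_max k00.
have ttc : continuous tt.
  move=> k; apply: cvgB; first exact: cvg_cst.
  apply: cvgM; first exact: cvg_cst.
  apply: cvgV; first by rewrite gt_eqF.
  by apply: continuous_max; [exact: cvg_cst|exact: cvg_id].
have tt0 k : 0 <= tt k by rewrite subr_ge0 ler_pdivrMr// mul1r le_max lexx.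
have tt1 k : tt k < 1 by rewrite gtrBl divr_gt0.
(* The solution [k] of [1 - k0 / k = T]; the parameter 1 corresponds to infinite gain. *)
pose k1 := if T == 1 then +oo%E else (k0 / (1 - T))%:E.
have ttT k : (k%:E < k1)%E -> tt k < T.
  rewrite /k1; have [->|TN1] := eqVneq T 1; first by rewrite tt1.
  have T1' : 0 < 1 - T by rewrite subr_gt0 lt_neqAle TN1.
  rewrite lte_fin => kk1; rewrite ltrBlDl -ltrBlDr ltr_pdivlMr// mulrC -ltr_pdivlMr//.
  by rewrite gt_max kk1 andbT ltr_pdivlMr// gtr_pMr// gtrBl.
have endk1 : ProperFilter (end_filter k1).
  by rewrite /k1; case: ifP => _ /=; apply: _.
have neark1 : \forall k \near end_filter k1, (k%:E < k1)%E /\ k0 <= k.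
  rewrite /k1; have [_|TN1] := eqVneq T 1.
    by near=> k; split; [exact: ltry|near: k; apply: nbhs_pinfty_ge; exact: num_real].
  have T1' : 0 < 1 - T by rewrite subr_gt0 lt_neqAle TN1.
  near=> k; split; first by rewrite lte_fin; near: k; exact: nbhs_left_lt.
  near: k; apply: nbhs_left_ge; by rewrite ltr_pdivlMr// gtr_pMr// gtrBl.
have cvtt : tt k @[k --> end_filter k1] --> T.
  rewrite /k1; have [->|TN1] := eqVneq T 1.
    apply/cvgrPdist_lt => e e0; near=> k.
    rewrite /tt subKr ger0_norm ?divr_ge0 ?ltW//.
    rewrite ltr_pdivrMr// mulrC -ltr_pdivrMr// lt_max; apply/orP; right.
    by near: k; apply: nbhs_pinfty_gt; exact: num_real.
  have T1' : 0 < 1 - T by rewrite subr_gt0 lt_neqAle TN1.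
  have ttK : tt (k0 / (1 - T)) = T.
    have le1 : k0 <= k0 / (1 - T) by rewrite ler_pdivlMr// ger_pMr// gerBl ltW.
    by rewrite /tt (max_idPr le1) invf_div mulrCA divff ?gt_eqF// mulr1 subKr.
  rewrite -[X in _ --> X]ttK; apply: cvg_at_left_filter; exact: ttc.
exists k1, (fun k => c + (w (tt k))^-1); split.
- rewrite /k1; case: eqVneq => [_|TN1]; first exact: ltry.
  have T1' : 0 < 1 - T by rewrite subr_gt0 lt_neqAle TN1.
  by rewrite lte_fin ltr_pdivlMr// gtr_pMr// gtrBl.
- move=> k kk0; have -> : tt k = 0 by rewrite /tt (max_idPl kk0) divff ?gt_eqF// subrr.
  by rewrite w0E invrK [c + _]addrC subrK.
- move=> k /ttT kT; apply: cvgD; first exact: cvg_cst.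
  apply: (@cvgV R[i]); first by rewrite -cnorm_eq0 wT0// tt0.
  by apply: (@continuous_comp _ _ _ tt w); [exact: ttc|exact: wc].
- move=> k k0k /ttT kT; have wN0 : w (tt k) != 0 by rewrite -cnorm_eq0 wT0// tt0.
  have := pencilE _ _ wN0 (wroot (tt k) _).
  rewrite tt0 ltW// => /(_ isT); rewrite {2}/tt (max_idPr k0k) subKr.
  have kp : 0 < k := lt_le_trans k00 k0k.
  have kC : k%:C != 0 :> R[i].
    by rewrite -(rmorph0 (real_complex R)) (inj_eq (@complexI R)) gt_eqF.
  set s := c + _; rewrite rmorphM fmorphV/= -mulrA => /(mulfI k0C) ->.
  by rewrite mulrA divff// mul1r.
- have cvw : w (tt k) @[k --> end_filter k1] --> w T.
    by apply: (cvg_comp tt w cvtt); exact: wc.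
  (* If [w T = 0] the branch goes to infinity. Otherwise [T = 1], where the pencil reduces to a
     multiple of [N], so the limit is a zero of [N]. *)
  have [wTz|wTN] := eqVneq (w T) 0.
    right; apply/cvgryPge => M.
    have M0 : 0 < `|M| + cnorm c + 1 by rewrite ltr_wpDl// addr_ge0// cnorm_ge0.
    have M0' : 0 < (`|M| + cnorm c + 1)^-1 by rewrite invr_gt0.
    have /cvg_cnormP/(_ _ M0') := cvw; apply: filterS2 neark1 => k [kk1 _].
    rewrite wTz sub0r cnormN => wM.
    have wN : 0 < cnorm (w (tt k)) by rewrite lt_def cnorm_ge0 andbT wT0// tt0 ttT.
    have : `|M| + cnorm c + 1 < (cnorm (w (tt k)))^-1.
      by rewrite -[X in X < _]invrK ltf_pV2 ?posrE ?invr_gt0.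
    rewrite -cnormV; have := cnorm_triangle (w (tt k))^-1 (- c) 0.
    rewrite !subr0 opprK cnormN [_^-1 + c]addrC; have := ler_norm M; lra.
  have T1E : T = 1 by case: wT => // /eqP; rewrite cnorm_eq0 (negbTE wTN).
  left; exists (c + (w T)^-1); last first.
    by apply: cvgD; [exact: cvg_cst|apply: (@cvgV R[i])].
  have := pencilE _ _ wTN (wroot T _); rewrite T1E ler01 lexx => /(_ isT).
  by rewrite subrr rmorph0 mul0r => /eqP; rewrite mulf_eq0 (negbTE k0C).
Unshelve. all: by end_near. Qed.

End Branches.

(** * Incoming branches and real arcs parametrized by the gain *)

Section RealArcs.
Variable R : realType.
Local Notation C := (R[i]^o).
Implicit Types (N D : {poly R[i]}).

Lemma cvg_to_within (T U : Type) (F : set_system T) (G : set_system U)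
    (E : set U) (f : T -> U) : Filter F ->
  f @ F --> G -> (\forall x \near F, E (f x)) -> f @ F --> within E G.
Proof. by move=> FF fG fE A GA; apply: filterS2 fE (fG _ GA) => x Ex; exact. Qed.

(* Swapping [N] and [D] turns [k] into [1 / k] and outgoing into incoming. *)
Lemma branch_in N D c (k0 : R) (s0 : R[i]) :
  0 < k0 -> root N c -> (forall s, root N s -> root D s -> False) ->
  k0%:C * N.[s0] = D.[s0] ->
  exists (k1 : R) (h : R -> C),
  [/\ 0 <= k1 < k0, forall k, k0 <= k -> h k = s0,
      forall k, k1 < k -> {for k, continuous h},
      forall k, k1 < k <= k0 -> k%:C * N.[h k] = D.[h k]
    & (exists2 s, root D s & h k @[k --> k1^'+] --> (s : C)) \/
      cnorm (h k) @[k --> k1^'+] --> +oo%R].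
Proof.
move=> k00 Nc NDco s0E.
have realN0 (k : R) : 0 < k -> k%:C != 0 :> R[i].
  by move=> k_gt0; rewrite -(rmorph0 (real_complex R)) (inj_eq (@complexI R)) gt_eqF.
have k0V : 0 < k0^-1 by rewrite invr_gt0.
have s0V : (k0^-1)%:C * D.[s0] = N.[s0].
  by rewrite -s0E mulrA -rmorphM/= mulVf ?gt_eqF// rmorph1 mul1r.
have [k1 [h [k01 hs hc hE hend]]] :=
  branch_out k0V Nc (fun s Ds Ns => NDco s Ns Ds) s0V.
(* An outgoing branch of the swapped problem that ends at infinite gain becomes a branch that starts
   at gain 0. *)
pose j1 : R := if k1 is r%:E%E then r^-1 else 0.
have j1P k : j1 < k -> 0 < k /\ ((k^-1)%:E < k1)%E.
  rewrite /j1; case: k1 k01 {hc hE hend j1} => [r| |]//=.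
    rewrite !lte_fin => k0r rk; have r0 : 0 < r := lt_trans k0V k0r.
    have k_gt0 : 0 < k by rewrite (lt_trans _ rk)// invr_gt0.
    by split=> //; rewrite -[r]invrK ltf_pV2// posrE invr_gt0.
  by move=> _ k_gt0; rewrite ltry.
have cvj : k^-1 @[k --> j1^'+] --> end_filter k1.
  rewrite /j1; case: k1 k01 {hc hE hend j1 j1P} => [r| |]//=.
    rewrite lte_fin => k0r; have r0 : 0 < r := lt_trans k0V k0r.
    have cr : k^-1 @[k --> r^-1^'+] --> r.
      apply: cvg_at_right_filter; rewrite -[X in _ --> X]invrK.
      by apply: inv_continuous; rewrite invr_eq0 gt_eqF.
    apply: cvg_to_within cr _.
    near=> k; have k_gt : r^-1 < k by near: k; exact: nbhs_right_gt.
    have k_gt0 : 0 < k by rewrite (lt_trans _ k_gt)// invr_gt0.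
    by rewrite -[r]invrK ltf_pV2// posrE invr_gt0.
  move=> _; apply/cvgryPgt => M; near=> k.
  have k_gt0 : 0 < k by near: k; exact: nbhs_right_gt.
  have M0 : 0 < `|M| + 1 by rewrite ltr_wpDl.
  have kM : k < (`|M| + 1)^-1 by near: k; apply: nbhs_right_lt; rewrite invr_gt0.
  rewrite (@lt_trans _ _ (`|M| + 1))//; first by rewrite (le_lt_trans (ler_norm M))// ltrDl.
  by rewrite -[X in X < _]invrK ltf_pV2// posrE invr_gt0.
exists j1, (fun k => h k^-1); split.
- rewrite /j1; case: k1 k01 {hc hE hend j1 j1P cvj} => [r| |]//=; last by rewrite lexx.
  rewrite lte_fin => k0r; have r0 : 0 < r := lt_trans k0V k0r.
  by rewrite invr_ge0 ltW//= -[k0]invrK ltf_pV2// posrE.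
- move=> k k0k; apply: hs; rewrite lef_pV2// posrE; exact: lt_le_trans k0k.
- move=> k /j1P[k_gt0 kk1]; apply: (@continuous_comp _ _ _ (fun k : R => k^-1) h).
    by apply: inv_continuous; rewrite gt_eqF.
  exact: hc.
- move=> k /andP[/j1P[k_gt0 kk1] kk0].
  have <- : (k^-1)%:C * D.[h k^-1] = N.[h k^-1] by apply: hE => //; rewrite lef_pV2.
  by rewrite mulrA -rmorphM/= mulfV ?gt_eqF// rmorph1 mul1r.
- case: hend => [[s Ds hl]|hl]; [left; exists s => //|right].
    exact: (cvg_comp (fun k : R => k^-1) h cvj hl).
  exact: (cvg_comp (fun k : R => k^-1) (fun k => cnorm (h k)) cvj hl).
Unshelve. all: by end_near. Qed.

(** An injective continuous function on a segment is monotone, here increasing since [f a < f b];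
    [y] is its inverse, extended by constants. With [f] the gain, [y] is a piece of root locus
    parametrized as [root_locus] demands. *)
Lemma real_arc (f : R -> R) (a b : R) : continuous f -> a < b -> f a < f b ->
  {in `[a, b] &, injective f} ->
  exists y : R -> R,
  [/\ continuous y, forall k, k <= f a -> y k = a, forall k, f b <= k -> y k = b,
      forall k, f a <= k <= f b -> a <= y k <= b /\ f (y k) = k
    & forall x, a <= x <= b -> f a <= f x <= f b /\ y (f x) = x].
Proof.
move=> fc ab fab finj; have [abW fabW] := (ltW ab, ltW fab).
have fcw : {within `[a, b], continuous f} by apply: continuous_subspaceT.
pose g k := xget a [set x | a <= x <= b /\ f x = k].
have gK x : a <= x <= b -> g (f x) = x.
  move=> xab; rewrite /g; case: xgetP => [z _ [zab /finj ->//]|/(_ x)[]//];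
  by rewrite in_itv.
have fle : {in `[a, b] &, {mono f : x y / x <= y}}.
  have [/le_mono_in //|/le_nmono_in fm] := itv_continuous_inj_mono fcw finj.
  move: fab; rewrite ltNge fm ?ltW//; rewrite in_itv/= lexx ltW//.
have gc : {within `[f a, f b], continuous g}.
  apply: segment_can_le_continuous (ltW ab) fcw _.
  by move=> x; rewrite in_itv => /gK.
have fsurj k : f a <= k <= f b -> exists2 x, a <= x <= b & f x = k.
  move=> kab; have [|x] := @IVT R f a b k (ltW ab) fcw.
    by rewrite (min_idPl (ltW fab)) (max_idPr (ltW fab)).
  by rewrite in_itv => xab <-; exists x.
exists (g \o clamp (f a) (f b)); split.
- move=> k; have kc := clamp_itv k (ltW fab).
  have := (subspace_continuousP _ _).1 gc (clamp (f a) (f b) k) kc.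
  apply: cvg_comp; apply: cvg_to_within; first exact: clamp_continuous.
  by apply: filterE => z; rewrite /= in_itv; apply: clamp_itv; exact: ltW.
- by move=> k ka; rewrite /= clamp_le// gK// lexx.
- by move=> k kb; rewrite /= clamp_ge// gK// lexx andbT.
- move=> k kab; rewrite /= clamp_id//; have [x xab <-] := fsurj k kab.
  by rewrite gK.
- move=> x xab; have fx : f a <= f x <= f b.
    case/andP: (xab) => ax xb; rewrite !fle ?ax ?in_itv//= ?lexx ?ax ?xb ?(ltW ab)//.
  by rewrite fx /= clamp_id// gK.
Qed.

Lemma real_complex_continuous : continuous (fun x : R => x%:C : C).
Proof.
move=> x; apply/cvg_cnormP => e e0; near=> y.
rewrite -rmorphB cnormR; near: y; move: e e0; apply/cvgrPdist_lt; exact: cvg_id.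
Unshelve. all: by end_near. Qed.

(* A branch arriving at [y kb] along the real arc [y]. *)
Lemma approach N D c (y : R -> R) (ka kb : R) :
  0 < ka < kb -> root N c -> (forall s, root N s -> root D s -> False) ->
  continuous y -> (forall k, k <= ka -> y k = y ka) ->
  (forall k, ka <= k <= kb -> k%:C * N.[(y k)%:C] = D.[(y k)%:C]) ->
  exists (k1 : R) (g : R -> C),
  [/\ 0 <= k1 < ka, forall k, ka <= k -> g k = (y k)%:C,
      forall k, k1 < k -> {for k, continuous g},
      forall k, k1 < k <= kb -> k%:C * N.[g k] = D.[g k]
    & (exists2 s, root D s & g k @[k --> k1^'+] --> (s : C)) \/
      cnorm (g k) @[k --> k1^'+] --> +oo%R].
Proof.
move=> /andP[ka0 kab] Nc NDco yc yka yE.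
have [|k1 [h [k1a hs hc hE hend]]] := branch_in ka0 Nc NDco (yE ka _).
  by rewrite lexx ltW.
(* [h] rests at [y ka] from [ka] on, and [y] rests there up to [ka], so one of the two terms is
   always inert. *)
pose g k : C := h k + ((y k)%:C - (y ka)%:C).
have gh k : k <= ka -> g k = h k by move=> kka; rewrite /g yka// subrr addr0.
have gy k : ka <= k -> g k = (y k)%:C by move=> kka; rewrite /g hs// addrC subrK.
have nearg : \forall k \near k1^'+, h k = g k.
  near=> k; rewrite gh//; near: k; apply: nbhs_right_le; by case/andP: k1a.
exists k1, g; split; [exact: k1a|exact: gy| | |].
- move=> k k1k; apply: cvgD; first exact: hc.
  apply: cvgD; last exact: cvg_cst.
  apply: (@continuous_comp _ _ _ y (fun x : R => x%:C : C)); first exact: yc.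
  exact: real_complex_continuous.
- move=> k /andP[k1k kkb]; have [kka|/ltW kka] := leP k ka.
    by rewrite gh// hE// k1k.
  by rewrite gy// yE// kka.
- case: hend => [[s Ds hl]|hl]; [left; exists s => //|right].
    by apply: cvg_trans hl; apply: near_eq_cvg.
  apply: cvg_trans hl; apply: near_eq_cvg; apply: filterS nearg => k ->//.
Unshelve. all: by end_near. Qed.

Lemma conj_continuous : continuous (fun z : C => z^*%C : C).
Proof.
move=> z; apply: (cvg_cnormP _ _ (nbhs_filter z)).2 => e e0.
have zz : (fun w : C => w) @ nbhs z --> z by exact: cvg_id.
have := (cvg_cnormP (fun w : C => w) z (nbhs_filter z)).1 zz e e0.
by apply: filterS => w; rewrite -rmorphB cnorm_conj.
Qed.

Lemma horner_conj (q : {poly R}) (s : R[i]) :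
  (map_poly (real_complex R) q).[s^*%C] = ((map_poly (real_complex R) q).[s])^*%C.
Proof.
rewrite -[RHS]horner_map; congr (_.[_]).
by apply/polyP => i; rewrite !coef_map/= oppr0.
Qed.

End RealArcs.

(** * Breakaway at a maximum of the gain *)

Section Breakaway.
Variables (R : realType) (p : {poly R}).
Local Notation C := (R[i]^o).
Local Notation N := (PPnum p).
Local Notation D := (PPden p).
Local Notation toC := (map_poly (real_complex R)).

(** The real gain without the absolute value: a rational function that can be differentiated. It
    agrees with [gain] once it is known to be nonnegative. *)
Definition gainR (x : R) : R := D.[x] / N.[x].
Local Notation K := gainR.

Hypothesis coND : coprimep N D.
Hypothesis N0 : forall x, N.[x] != 0.
Hypothesis Kge0 : forall x, 0 <= K x.

Let NDco s : root (toC N) s -> root (toC D) s -> False.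
Proof.
have : coprimep (toC N) (toC D) by rewrite coprimep_map.
by move=> /coprimep_root co /co /negP.
Qed.

Let toC_horner (q : {poly R}) (x : R) : (toC q).[x%:C] = (q.[x])%:C.
Proof. by rewrite horner_map. Qed.

Let real_neq0 (k : R) : k != 0 -> k%:C != 0 :> R[i].
Proof. by rewrite -(inj_eq (@complexI R)) rmorph0. Qed.

Lemma gainR_sol k x : K x = k <-> k%:C * (toC N).[x%:C] = (toC D).[x%:C].
Proof.
rewrite !toC_horner -rmorphM /gainR; split=> [<-|/complexI <-].
  by rewrite divfK.
by rewrite mulfK.
Qed.

Lemma gain_real x : gain p x%:C = (K x)%:E.
Proof.
rewrite /gain asboolF; last first.
  by rewrite /PPzero /evalC toC_horner => /eqP; apply/negP/real_neq0.
congr (_%:E); rewrite /evalC !toC_horner -fmorphV -rmorphM -[LHS]/(cnorm _).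
by rewrite cnormR; exact: ger0_norm (Kge0 x).
Qed.

Lemma sol_neq0 k s : 0 < k -> k%:C * (toC N).[s] = (toC D).[s] ->
  (toC N).[s] != 0 /\ (toC D).[s] != 0.
Proof.
move=> k0 e; have N_neq0 : (toC N).[s] != 0.
  apply/negP => Ns; apply: (@NDco s) => //.
  by rewrite /root -e (eqP Ns) mulr0.
by split=> //; rewrite -e mulf_neq0// real_neq0// gt_eqF.
Qed.

Lemma sol_PP k s : 0 < k -> k%:C * (toC N).[s] = (toC D).[s] ->
  k%:C * PP p s = 1.
Proof.
move=> k0 /[dup] /(sol_neq0 k0)[_ Ds] e.
by rewrite /PP /evalC mulrA e divff.
Qed.

Lemma gainR_continuous : continuous K.
Proof.
move=> x; apply: cvgM; first exact: continuous_horner.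
by apply: cvgV => //; exact: continuous_horner.
Qed.

Lemma evalC_continuous (q : {poly R}) : continuous (evalC q).
Proof.
move=> z; apply: (cvg_cnormP _ _ (nbhs_filter z)).2 => e e0.
have [d d0 qd] := horner_cont (toC q) z e0.
have zz : (fun w : C => w) @ nbhs z --> z by exact: cvg_id.
have := (cvg_cnormP (fun w : C => w) z (nbhs_filter z)).1 zz d d0.
by apply: filterS => w; rewrite cnormC => /qd; rewrite cnormC.
Qed.

(** The [2q pi] case of [root_locus] with its equation cleared of the denominator. *)
Definition branch (k1 : R) (k2 : \bar R) (g : R -> C) : Prop :=
  [/\ 0 <= k1 /\ (k1%:E < k2)%E,
      forall k, k1 < k /\ (k%:E < k2)%E ->
        {for k, continuous g} /\ k%:C * (toC N).[g k] = (toC D).[g k],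
      (exists2 s, root (toC D) s & g k @[k --> k1^'+] --> (s : C)) \/
        cnorm (g k) @[k --> k1^'+] --> +oo%R
    & (exists2 s, root (toC N) s & g k @[k --> end_filter k2] --> (s : C)) \/
        cnorm (g k) @[k --> end_filter k2] --> +oo%R].

Lemma branch_locus k1 k2 g : branch k1 k2 g ->
  root_locus p (g @` [set k | k1 < k /\ (k%:E < k2)%E]).
Proof.
move=> [[k10 k12] gc gs ge]; exists false, k1, k2, g; split=> //.
- move=> k /[dup] -[k1k _] /gc[gk e]; split=> //.
  rewrite expr0; apply: sol_PP e; exact: le_lt_trans k1k.
- by case: gs => [[s /eqP Ds sl]|sl]; [left; exists s|right].
- by case: ge => [[s /eqP Ns sl]|sl]; [left; exists s|right].
Qed.

(** As each arc equals [s0] beyond the junction, [g + (h - s0)] is continuous without a separate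
    argument at [kb]. *)
Lemma branch_glue k1 ka kb k2 (g h : R -> C) s0 :
  0 <= k1 < ka -> ka < kb -> (kb%:E < k2)%E ->
  (forall k, kb <= k -> g k = s0) -> (forall k, k <= kb -> h k = s0) ->
  (forall k, k1 < k -> {for k, continuous g}) ->
  (forall k, (k%:E < k2)%E -> {for k, continuous h}) ->
  (forall k, k1 < k <= kb -> k%:C * (toC N).[g k] = (toC D).[g k]) ->
  (forall k, kb <= k -> (k%:E < k2)%E -> k%:C * (toC N).[h k] = (toC D).[h k]) ->
  (exists2 s, root (toC D) s & g k @[k --> k1^'+] --> (s : C)) \/
    cnorm (g k) @[k --> k1^'+] --> +oo%R ->
  (exists2 s, root (toC N) s & h k @[k --> end_filter k2] --> (s : C)) \/
    cnorm (h k) @[k --> end_filter k2] --> +oo%R ->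
  exists f : R -> C, [/\ branch k1 k2 f, forall k, k <= kb -> f k = g k
    & forall k, kb <= k -> f k = h k].
Proof.
move=> /andP[k10 k1a] kab kb2 gs hs gc hc gE hE gend hend.
have k1b := lt_trans k1a kab.
pose f k : C := g k + (h k - s0).
have fg k : k <= kb -> f k = g k by move=> kkb; rewrite /f hs// subrr addr0.
have fh k : kb <= k -> f k = h k by move=> kkb; rewrite /f gs// addrC subrK.
exists f; split=> //; split.
- by split=> //; rewrite (lt_trans _ kb2)// lte_fin.
- move=> k [k1k kk2]; split.
    apply: cvgD; first exact: gc.
    by apply: cvgD; [exact: hc|exact: cvg_cst].
  have [kkb|/ltW kkb] := leP k kb; first by rewrite fg// gE// k1k.
  by rewrite fh// hE.
- have near1 : \forall k \near k1^'+, g k = f k.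
    by near=> k; rewrite fg//; near: k; apply: nbhs_right_le.
  case: gend => [[s Ds gl]|gl]; [left; exists s => //|right].
    by apply: cvg_trans gl; apply: near_eq_cvg.
  by apply: cvg_trans gl; apply: near_eq_cvg; apply: filterS near1 => k ->.
- have near2 : \forall k \near end_filter k2, h k = f k.
    case: k2 kb2 {hc hE hend} => [r| |]//= kbr.
      by near=> k; rewrite fh//; near: k; apply: nbhs_left_ge.
    by near=> k; rewrite fh//; near: k; apply: nbhs_pinfty_ge; exact: num_real.
  have k2F : Filter (end_filter k2) by case: k2 {kb2 hc hE hend near2} => [r| |]/=; apply: _.
  case: hend => [[s Ns hl]|hl]; [left; exists s => //|right].
    by apply: cvg_trans hl; apply: near_eq_cvg.
  by apply: cvg_trans hl; apply: near_eq_cvg; apply: filterS near2 => k ->.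
Unshelve. all: by end_near. Qed.

(** Two branches through the same point pass it at the same parameter, so an intersection of loci is
    an equality of parametrizations at one [k]. *)
Lemma gain_pinned z k k' : 0 < k -> 0 < k' ->
  k%:C * (toC N).[z] = (toC D).[z] -> k'%:C * (toC N).[z] = (toC D).[z] -> k = k'.
Proof.
move=> k0 k'0 e e'; have [Nz _] := sol_neq0 k0 e.
by apply/complexI/(mulIf Nz); rewrite e.
Qed.

(** By continuity of [D / N] at [b], points near [b] have gain near [K b]. Common points near [b]
    are thus kept off the low-gain parts of the branches, about which nothing is known. *)
Lemma near_gain b kk : kk < K b ->
  \forall z \near (b%:C : C), forall k, 0 < k ->
    k%:C * (toC N).[z] = (toC D).[z] -> kk < k.
Proof.
move=> kkb; pose F (z : C) : C := evalC D z / evalC N z.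
have Nb : evalC N b%:C != 0 by rewrite /evalC toC_horner real_neq0.
have bF := nbhs_filter (b%:C : C).
have Fc : F @ nbhs (b%:C : C) --> F b%:C.
  apply: (@cvgM R[i] _ _ bF (evalC D) (fun z => (evalC N z)^-1)).
    exact: evalC_continuous.
  by apply: (@cvgV R[i] _ _ bF (evalC N)) => //; exact: evalC_continuous.
have Fb : F b%:C = (K b)%:C.
  by rewrite /F /evalC !toC_horner -fmorphV -rmorphM.
have e0 : 0 < K b - kk by rewrite subr_gt0.
have := (cvg_cnormP F (F b%:C) bF).1 Fc _ e0.
apply: filterS => z Fz k k0 e; have [Nz _] := sol_neq0 k0 e.
move: Fz; have -> : F z = k%:C by rewrite /F /evalC -e mulfK.
rewrite Fb -rmorphB cnormR => /ltr_normlP[]; lra.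
Qed.

(* The two branches reach [b] from the left and from the right along the real
   axis; past [b] one follows a nonreal arc [h] and the other its conjugate. *)
Lemma max_breakaway a b c : a < b < c -> 0 < K a -> 0 < K c ->
  {in `[a, b] &, injective K} -> {in `[b, c] &, injective K} ->
  (forall x, K x <= K b) ->
  (exists s, root (toC N) s) -> (exists s, root (toC D) s) ->
  max_real_breakaway p b.
Proof.
move=> /andP[ab bc] Ka0 Kc0 injl injr Kmax [rN NrN] [rD DrD].
have Kb0 : 0 < K b := lt_le_trans Ka0 (Kmax a).
have Kab : K a < K b.
  rewrite lt_neqAle Kmax andbT; apply/eqP => /injl; rewrite !in_itv/= !lexx !ltW//.
  by move=> /(_ isT isT) eab; rewrite eab ltxx in ab.
have Kcb : K c < K b.
  rewrite lt_neqAle Kmax andbT; apply/eqP => /injr; rewrite !in_itv/= !lexx !ltW//.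
  by move=> /(_ isT isT) ebc; rewrite ebc ltxx in bc.
have [y1 [y1c y1a y1b y1K y1V]] := real_arc gainR_continuous ab Kab injl.
(* To the right of [b] the gain decreases; the reflection [x -> - x] brings this arc under
   [real_arc]. *)
have KNc : continuous (fun x => K (- x)).
  by move=> x; apply: (@continuous_comp _ _ _ -%R K); [exact: opp_continuous|exact: gainR_continuous].
have bc' : - c < - b by rewrite ltrN2.
have [||y2' [y2c y2a y2b y2K y2V]] := real_arc KNc bc'.
- by rewrite !opprK.
- move=> x y; rewrite !in_itv/= => xI yI /injr; rewrite !in_itv/= => e; apply: oppr_inj.
  by apply: e; rewrite lerNr lerNl andbC.
rewrite !opprK in y2a y2b y2K y2V.
pose y2 k := - y2' k.
have [|||k1 [g1 [k1a g1y g1c g1E g1s]]]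
  := @approach _ (toC N) (toC D) rN y1 (K a) (K b) _ NrN NDco y1c.
- by rewrite Ka0.
- by move=> k kk; rewrite !y1a.
- by move=> k /y1K[_ /gainR_sol].
have y2cont : continuous y2 by move=> k; apply: cvgN; exact: y2c.
have [|||k2 [g2 [k2a g2y g2c g2E g2s]]]
  := @approach _ (toC N) (toC D) rN y2 (K c) (K b) _ NrN NDco y2cont.
- by rewrite Kc0.
- by move=> k kk; rewrite /y2 !y2a.
- by move=> k /y2K[_ /gainR_sol].
have solb : (K b)%:C * (toC N).[b%:C] = (toC D).[b%:C] by apply/gainR_sol.
have [kout [h [bout hs hc hE hend]]] := branch_out Kb0 DrD NDco solb.
have g1b k : K b <= k -> g1 k = b%:C.
  by move=> kb; rewrite g1y ?y1b// (le_trans (ltW Kab)).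
have g2b k : K b <= k -> g2 k = b%:C.
  by move=> kb; rewrite g2y /y2 ?y2b ?opprK// (le_trans (ltW Kcb)).
have [f1 [br1 f1g f1h]] := branch_glue k1a Kab bout g1b hs g1c hc g1E hE g1s hend.
pose hj k : C := (h k)^*%C.
have [||||f2 [br2 f2g f2h]] := branch_glue (h := hj) k2a Kcb bout g2b _ g2c _ g2E _ g2s _.
- by move=> k kb; rewrite /hj hs// conjc_real.
- move=> k kk; apply: (@continuous_comp _ _ _ h (fun z : C => z^*%C : C)); first exact: hc.
  exact: conj_continuous.
- by move=> k kb kk; rewrite /hj !horner_conj -hE// rmorphM/= oppr0.
- have outF : Filter (end_filter kout) by case: (kout) => [r| |]/=; apply: _.
  case: hend => [[s Ns hl]|hl]; [left; exists s^*%C|right].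
  + by rewrite /root horner_conj (eqP Ns) rmorph0.
  + apply: (cvg_comp h (fun z : C => z^*%C : C) hl); exact: conj_continuous.
  + apply: cvg_trans hl; apply: near_eq_cvg; apply: filterE => k.
    by rewrite /hj cnorm_conj.
pose I1 := [set k | k1 < k /\ (k%:E < kout)%E].
pose I2 := [set k | k2 < k /\ (k%:E < kout)%E].
have I1_gt0 k : I1 k -> 0 < k by case=> + _; apply: le_lt_trans; case/andP: k1a.
have I2_gt0 k : I2 k -> 0 < k by case=> + _; apply: le_lt_trans; case/andP: k2a.
have sol1 k : I1 k -> k%:C * (toC N).[f1 k] = (toC D).[f1 k] by case: br1 => _ br _ _ /br[].
have sol2 k : I2 k -> k%:C * (toC N).[f2 k] = (toC D).[f2 k] by case: br2 => _ br _ _ /br[].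
(* Above the gain [kk] both branches are explicit: real arcs up to [K b], then [h] and its
   conjugate. *)
pose kk := Num.max (K a) (K c).
have kkb : kk < K b by rewrite gt_max Kab.
have lft k : kk < k -> k < K b -> exists2 x, a <= x < b & f1 k = x%:C.
  move=> kkk kb; have kab : K a <= k <= K b.
    by move: kkk; rewrite gt_max => /andP[/ltW -> _]; exact: ltW.
  have [/andP[ax xb] yK] := y1K _ kab; exists (y1 k).
    rewrite ax lt_neqAle xb andbT; apply/eqP => e; by rewrite -yK e ltxx in kb.
  by rewrite f1g ?g1y//; case/andP: kab.
have rgt k : kk < k -> k < K b -> exists2 x, b < x <= c & f2 k = x%:C.
  move=> kkk kb; have kcb : K c <= k <= K b.
    by move: kkk; rewrite gt_max => /andP[_ /ltW ->]; exact: ltW.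
  have [/andP[cx xb] yK] := y2K _ kcb; exists (y2 k).
    rewrite lerNl cx andbT lt_neqAle lerNr xb andbT; apply/eqP => e.
    by rewrite -yK -/(y2 k) -e ltxx in kb.
  by rewrite f2g ?g2y//; case/andP: kcb.
(* Below [K b] the two points lie strictly on opposite sides of [b]. Above it, [h k] equal to its
   conjugate would be a real point whose gain exceeds the maximum. *)
have disj k : kk < k -> k != K b -> (k%:E < kout)%E -> f1 k <> f2 k.
  move=> kkk kNb kout_; case: (ltgtP k (K b)) kNb => [kb|kb|->]; rewrite ?eqxx// => _.
    have [x /andP[_ xb] ->] := lft k kkk kb; have [x' /andP[bx' _] ->] := rgt k kkk kb.
    by move=> /complexI e; move: (lt_trans xb bx'); rewrite e ltxx.
  rewrite f1h ?f2h ?ltW// /hj => e.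
  have hR : h k = (complex.Re (h k))%:C.
    move: e; case: (h k) => u v /= [] /eqP; rewrite -subr_eq0 opprK -mulr2n mulrn_eq0/=.
    by move=> /eqP ->.
  have /gainR_sol Kh : k%:C * (toC N).[(complex.Re (h k))%:C] = (toC D).[(complex.Re (h k))%:C].
    by rewrite -hR hE// ltW.
  by move: (Kmax (complex.Re (h k))); rewrite Kh leNgt kb.
have kkI1 k : kk < k -> (k%:E < kout)%E -> I1 k.
  move=> kkk ko; split=> //; case/andP: k1a => _ /lt_trans; apply.
  by move: kkk; rewrite gt_max => /andP[].
have kkI2 k : kk < k -> (k%:E < kout)%E -> I2 k.
  move=> kkk ko; split=> //; case/andP: k2a => _ /lt_trans; apply.
  by move: kkk; rewrite gt_max => /andP[].
have loc1 := branch_locus br1; have loc2 := branch_locus br2.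
rewrite -/I1 in loc1; rewrite -/I2 in loc2.
have L1b : (f1 @` I1) b%:C by exists (K b); [exact: kkI1|rewrite f1g// g1b].
have L2b : (f2 @` I2) b%:C by exists (K b); [exact: kkI2|rewrite f2g// g2b].
have meet z : (f1 @` I1) z -> (f2 @` I2) z -> exists k,
    [/\ I1 k, I2 k, f1 k = z & f2 k = z].
  move=> [k I1k f1k] [k' I2k' f2k']; exists k.
  have e : k = k'.
    apply: (@gain_pinned z); [exact: I1_gt0|exact: I2_gt0| |].
      by rewrite -f1k; exact: sol1.
    by rewrite -f2k'; exact: sol2.
  by rewrite e in I1k f1k *; split.
have Kl x : a < x < b -> K x < K b /\ (f1 @` I1) x%:C.
  move=> /andP[ax xb]; have xI : a <= x <= b by rewrite !ltW.
  have [/andP[Kax Kxb] yx] := y1V _ xI.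
  have Kxb' : K x < K b.
    rewrite lt_neqAle Kxb andbT; apply/eqP => e; move: yx xb.
    by rewrite e y1b// => ->; rewrite ltxx.
  split=> //; exists (K x); last by rewrite f1g ?g1y ?yx.
  split; last by rewrite (lt_trans _ bout)// lte_fin.
  by case/andP: k1a => _ /lt_le_trans; apply.
have Kr x : b < x < c -> K x < K b /\ (f2 @` I2) x%:C.
  move=> /andP[bx xc]; have xI : - c <= - x <= - b by rewrite !lerN2 !ltW.
  have [/andP[Kax Kxb] yx] := y2V _ xI; rewrite !opprK in Kax Kxb yx.
  have Kxb' : K x < K b.
    rewrite lt_neqAle Kxb andbT; apply/eqP => e; move: yx bx.
    by rewrite e y2b// => /oppr_inj ->; rewrite ltxx.
  split=> //; exists (K x); last by rewrite f2g ?g2y /y2 ?yx ?opprK.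
  split; last by rewrite (lt_trans _ bout)// lte_fin.
  by case/andP: k2a => _ /lt_le_trans; apply.
have nearl : \forall x \near b^'-, a < x < b.
  by near=> x; apply/andP; split; near: x; [exact: nbhs_left_gt|exact: nbhs_left_lt].
have nearr : \forall x \near b^'+, b < x < c.
  by near=> x; apply/andP; split; near: x; [exact: nbhs_right_gt|exact: nbhs_right_lt].
split; last by apply: filterE => x; rewrite !gain_real lee_fin.
split.
  split.
  - by rewrite /PPzero /evalC toC_horner => /eqP; apply/negP/real_neq0.
  - by rewrite /PPpole => /eqP; apply/negP; have [] := sol_neq0 Kb0 solb.
  - exists (f1 @` I1), (f2 @` I2); split=> //.
    apply: filterS (near_gain kkb) => z zK zb [L1z L2z].
    have [k [I1k I2k f1k f2k]] := meet z L1z L2z.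
    have kkk : kk < k.
      by apply: zK; [exact: I1_gt0|rewrite -f1k; exact: sol1].
    have [e|kNb] := eqVneq k (K b).
      by move/eqP: zb; apply; rewrite -f1k e f1g// g1b.
    by apply: (disj k) => //; [case: I1k|rewrite f1k].
exists (f1 @` I1), (f2 @` I2); split=> //.
(* If the loci coincided, a point of gain between [kk] and [K b] on the first would lie on the
   second at the same parameter, against [disj]. *)
- move=> L12; pose k := (kk + K b) / 2.
  have [kkk kb] : kk < k /\ k < K b by rewrite /k; split; lra.
  have ko : (k%:E < kout)%E by rewrite (lt_trans _ bout)// lte_fin.
  have L1z : (f1 @` I1) (f1 k) by exists k => //; exact: kkI1.
  have L2z : (f2 @` I2) (f1 k) by rewrite -L12.
  have [k' [I1k' I2k' e1 e2]] := meet _ L1z L2z.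
  have e : k = k'.
    apply: (@gain_pinned (f1 k)); [exact/I1_gt0/kkI1|exact: I1_gt0|exact/sol1/kkI1|].
    by rewrite -e1; exact: sol1.
  by apply: (disj k) => //; [rewrite lt_eqF|rewrite [in RHS]e].
- split; [apply: filterS nearl|apply: filterS nearr] => x.
    by move=> /Kl[].
  by move=> /Kr[].
- left; split; [apply: filterS nearl|apply: filterS nearr] => x.
    by move=> /Kl[]; rewrite !gain_real lte_fin.
  by move=> /Kr[]; rewrite !gain_real lte_fin.
Unshelve. all: by end_near. Qed.

End Breakaway.

(** * Real polynomials *)

Section RealPolynomials.
Variable R : realType.
Implicit Types (f p q : {poly R}) (x y z : R).

Lemma mem_rootsR f z : f != 0 -> (z \in rootsR f) = root f z.
Proof. by move=> f0; rewrite -(roots_on_rootsR f0) in_itv. Qed.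

Lemma uniq_rootsR f : uniq (rootsR f).
Proof. exact: uniq_roots. Qed.

Lemma sharp_r_ge0 f : (0 <= sharp_r f)%E.
Proof. by rewrite /sharp_r; case: ifP => // _; rewrite lee_fin. Qed.

Lemma sharp_r_gt0 f : (0 < sharp_r f)%E <-> exists x, root f x.
Proof.
rewrite /sharp_r; have [->|f0] := eqVneq f 0.
  by split=> // _; exists 0; exact: root0.
rewrite lte_fin ltr0n; split=> [|[x fx]].
  case E: (rootsR f) => [|x s]; first by rewrite big_nil.
  by exists x; rewrite -mem_rootsR// E mem_head.
by rewrite (big_rem x) ?mem_rootsR//= addn_gt0 mu_gt0// fx.
Qed.

(** Allows the zeros of a polynomial and of one of its factors to be counted over the same list. *)
Lemma zeros_right_sub f x (s : seq R) : f != 0 -> uniq s ->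
  {subset rootsR f <= s} ->
  nb_zeros_right f x = (\sum_(z <- s | (x < z)%R) \mu_z f)%N.
Proof.
move=> f0 su fs; rewrite [RHS](bigID (mem (rootsR f)))/=.
rewrite [X in (_ + X)%N]big1 ?addn0; last first.
  by move=> z /andP[_]; rewrite mem_rootsR//; exact: muNroot.
rewrite -[RHS]big_filter /nb_zeros_right -[LHS]big_filter.
apply: perm_big; apply: uniq_perm; rewrite ?filter_uniq ?uniq_rootsR// => z.
by rewrite !mem_filter; case: (boolP (z \in rootsR f)) => [/fs ->|]; rewrite ?andbT ?andbF.
Qed.

(** Induction on the degree: dividing by ['X - z] with [z > x] changes the sign at [x] and lowers
    the count by one. When no zero remains to the right, the sign at [x] is the sign at [+oo]. *)
Lemma sg_zeros_right f x : ~~ root f x ->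
  Num.sg f.[x] = (-1) ^+ nb_zeros_right f x * Num.sg (lead_coef f).
Proof.
elim: {f}(size f) {-2}f (leqnn (size f)) => [|n IH] f szf fx.
  by move: szf fx; rewrite leqn0 size_poly_eq0 => /eqP ->; rewrite root0.
have f0 : f != 0 by apply: contraNneq fx => ->; exact: root0.
have [[z xz fz]|nz] := pselect (exists2 z, x < z & root f z).
  have /factor_theorem[g fE] := fz.
  have g0 : g != 0 by apply: contraNneq f0 => g0; rewrite fE g0 mul0r.
  have gx : ~~ root g x by apply: contra fx => gx; rewrite fE rootM gx.
  have szg : (size g <= n)%N.
    by move: szf; rewrite fE size_Mmonic ?monicXsubC// size_XsubC addn2.
  have -> : nb_zeros_right f x = (nb_zeros_right g x).+1.
    rewrite (@zeros_right_sub g x (rootsR f)) ?uniq_rootsR//; last first.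
      by move=> y; rewrite !mem_rootsR// fE rootM => ->.
    rewrite /nb_zeros_right fE; under eq_bigr => y _ do rewrite -fE fE mu_mul -?fE//.
    rewrite big_split/= addnC -addn1 addnC; congr (_ + _)%N.
    rewrite -fE (big_rem z) ?mem_rootsR//= xz mu_XsubC big1_seq// => y /andP[_].
    rewrite (mem_rem_uniq _ (uniq_rootsR f)) inE => /andP[yz _].
    by rewrite muNroot// root_XsubC.
  rewrite {1}fE hornerM sgrM IH// hornerXsubC [Num.sg (x - z)]ltr0_sg ?subr_lt0//.
  by rewrite fE lead_coefM lead_coefXsubC mulr1 exprS mulN1r mulNr mulrN1.
have -> : nb_zeros_right f x = 0%N.
  rewrite /nb_zeros_right big1_seq// => y /andP[xy]; rewrite mem_rootsR// => fy.
  by case: nz; exists y.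
rewrite expr0 mul1r; apply: (@sgp_pinftyP _ x); last by rewrite in_itv/= lexx.
move=> y; rewrite in_itv/= andbT le_eqVlt => /orP[/eqP <-//|xy].
by apply/negP => fy; apply: nz; exists y.
Qed.

Lemma even_degree_pos f : 0 < lead_coef f -> odd (size f) ->
  exists2 X, 0 < X & forall x, X <= `|x| -> 0 < f.[x].
Proof.
move=> lf sf; have f0 : f != 0 by rewrite -lead_coef_eq0 gt_eqF.
exists (cauchy_bound f); first exact: cauchy_bound_gt0.
move=> x; rewrite ler_normr => /orP[hx|hx]; rewrite -sgr_gt0.
  rewrite (sgp_pinftyP (ge_cauchy_bound f0)) ?in_itv/= ?hx//.
  by rewrite /sgp_pinfty sgr_gt0.
rewrite (sgp_minftyP (le_cauchy_bound f0)) ?in_itv/= 1?lerNr//.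
rewrite /sgp_minfty sgr_gt0 -signr_odd; case: (size f) sf => //= m.
by move=> /negPf ->; rewrite mul1r.
Qed.

Lemma continuous_max_attained (g : R -> R) x0 X : continuous g ->
  (forall x, X <= `|x| -> g x <= g x0) -> exists b, forall x, g x <= g b.
Proof.
move=> gc gX; pose Y := Num.max `|x0| `|X|.
have Y0 : 0 <= Y by rewrite le_max normr_ge0.
have [||b bY bmax] := @EVT_max R g (- Y) Y; first by rewrite ge0_cp.
  exact: continuous_subspaceT.
have x0b : g x0 <= g b.
  by apply: bmax; rewrite in_itv/= -ler_norml le_max lexx.
exists b => x; have [xY|Yx] := leP `|x| Y.
  by apply: bmax; rewrite in_itv/= -ler_norml.
apply: le_trans x0b; apply: gX; rewrite (le_trans _ (ltW Yx))//.
by rewrite le_max ler_norm orbT.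
Qed.

Lemma nonneg_limit f x : (forall y, x < y -> 0 <= f.[y]) -> 0 <= f.[x].
Proof.
move=> fy; rewrite leNgt; apply/negP => fx.
have cf : f.[y] @[y --> x^'+] --> f.[x].
  by apply: cvg_at_right_filter; exact: continuous_horner.
have [y] : exists y, f.[y] < 0 /\ x < y.
  apply: (@filter_ex _ (x^'+)); near=> y; split; near: y.
    by exact: (cvgr_lt _ cf).
  exact: nbhs_right_gt.
by move=> [fy0 xy]; have := fy _ xy; rewrite leNgt fy0.
Unshelve. all: by end_near. Qed.

(** Algebraic proof: [f - f.[x] = h * ('X - x)], where [h] is nonnegative to the right of [x] and
    nonpositive to the left, so it vanishes at [x]. Hence [h = g * ('X - x)] with [g] nonnegative to
    the right, and [f''] takes the value [2 g.[x]] at [x]. *)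
Lemma min_derivatives f x : (forall y, f.[x] <= f.[y]) ->
  root f^`() x /\ 0 <= (f^`(2)).[x].
Proof.
move=> fmin; have [h fE] : exists h, f - f.[x]%:P = h * ('X - x%:P).
  by apply/factor_theorem; rewrite /root !hornerE subrr.
have hE y : f.[y] - f.[x] = h.[y] * (y - x).
  by have := congr1 (horner^~ y) fE; rewrite /= hornerD hornerN hornerC hornerM hornerXsubC.
have hx : root h x.
  apply/eqP/le_anti/andP; split; last first.
    apply: nonneg_limit => y xy; have : 0 <= h.[y] * (y - x) by rewrite -hE subr_ge0.
    by rewrite pmulr_lge0// subr_gt0.
  have := @nonneg_limit (- (h \Po (- 'X))) (- x) _.
  rewrite hornerN horner_comp hornerN hornerX opprK oppr_ge0; apply => y xy.
  rewrite hornerN horner_comp hornerN hornerX oppr_ge0.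
  have : 0 <= h.[- y] * (- y - x) by rewrite -hE subr_ge0.
  by rewrite nmulr_lge0// subr_lt0 ltrNl.
have /factor_theorem[g hgE] := hx.
have f1 : f^`() = (g^`() * ('X - x%:P) + g *+ 2) * ('X - x%:P).
  have -> : f = g * ('X - x%:P) * ('X - x%:P) + f.[x]%:P by rewrite -hgE -fE subrK.
  by rewrite derivD derivC addr0 !derivM derivXsubC; ring.
have f2 : (f^`(2)).[x] = g.[x] *+ 2.
  rewrite derivnS derivn1 f1 !derivM derivXsubC derivD mulr1 hornerD !hornerM hornerXsubC.
  by rewrite subrr mulr0 add0r hornerD hornerM hornerXsubC subrr mulr0 add0r hornerMn.
split; first by rewrite f1 rootM root_XsubC eqxx orbT.
rewrite f2 mulrn_wge0//; apply: nonneg_limit => y xy.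
have : 0 <= h.[y] * (y - x) by rewrite -hE subr_ge0.
rewrite hgE hornerM hornerXsubC -mulrA -expr2 pmulr_lge0// exprn_gt0// subr_gt0//.
Qed.

Lemma rootless_sg f x y : (forall z, ~~ root f z) -> 0 < f.[x] -> 0 < f.[y].
Proof.
move=> f0; rewrite -[0 < f.[y]]sgr_gt0 -sgr_gt0.
by rewrite (@polyrN0_itv _ `]-oo, +oo[ f _ x y) ?in_itv.
Qed.

Lemma critical_point f : (forall z, ~~ root f z) -> odd (size f) ->
  exists2 x, root f^`() x & 0 <= f.[x] * (f^`(2)).[x].
Proof.
wlog lf : f / 0 < lead_coef f.
  move=> H f0 sf; have fn0 : f != 0 by apply: contraNneq (f0 0) => ->; exact: root0.
  have [lf|lf] := ltP 0 (lead_coef f); first exact: H.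
  have [|z||x x1 x2] := H (- f).
  - by rewrite lead_coefN oppr_gt0 lt_neqAle lf lead_coef_eq0 fn0.
  - by rewrite rootN.
  - by rewrite size_polyN.
  exists x; first by rewrite derivN rootN in x1.
  by move: x2; rewrite derivnN !hornerN mulrNN.
move=> f0 sf.
have f0pos : 0 < f.[0].
  by have [X X0 fX] := even_degree_pos lf sf; apply: (@rootless_sg f X) => //;
    apply: fX; rewrite ger0_norm// ltW.
have szf : (1 < size f)%N \/ size f = 1%N.
  by case: (size f) sf => [|[|m]]//; [right|left].
case: szf => [szf|/eqP/size_poly1P[c c0 fE]]; last first.
  by exists 0; rewrite fE ?derivC ?root0// derivnC/= horner0 mulr0.
(* Since [f - f.[0]] again has even degree and positive leading coefficient, [f] exceeds [f.[0]] far
   out, so its minimum is attained. *)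
have szg : size (f - f.[0]%:P) = size f.
  by rewrite size_polyDl// size_polyN (leq_ltn_trans (size_polyC_leq1 _)).
have lg : 0 < lead_coef (f - f.[0]%:P).
  by rewrite lead_coefDl// size_polyN (leq_ltn_trans (size_polyC_leq1 _)).
have sg : odd (size (f - f.[0]%:P)) by rewrite szg.
have [X X0 fX] := even_degree_pos lg sg.
have [||b bmin] := @continuous_max_attained (fun x => - f.[x]) 0 X.
- by move=> x; apply: cvgN; exact: continuous_horner.
- move=> x /fX; rewrite hornerD hornerN hornerC subr_gt0 lerN2; exact: ltW.
have [|f1 f2] := @min_derivatives f b; first by move=> y; rewrite -lerN2.
exists b => //; rewrite mulr_ge0// ltW//; exact: (rootless_sg (x := 0)).
Qed.

Lemma poly_ivt_le f x y : f.[x] <= 0 -> 0 <= f.[y] -> exists z, root f z.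
Proof.
move=> fx fy; have fxy : f.[x] * f.[y] <= 0 by rewrite mulr_le0_ge0.
have [xy|/ltW yx] := leP x y.
  by have [z _ zr] := polyrcf.poly_ivt xy fxy; exists z.
by rewrite mulrC in fxy; have [z _ zr] := polyrcf.poly_ivt yx fxy; exists z.
Qed.

Lemma root_deriv_mu f x : root f x -> (1 < \mu_x f)%N -> root f^`() x.
Proof.
move=> fx; rewrite -subn_gt0 -mu_deriv// => m.
have [->|f1] := eqVneq f^`() 0; first exact: root0.
by rewrite -mu_gt0.
Qed.

End RealPolynomials.

(** * The real gain *)

Section RationalGain.
Variables (R : realType) (p : {poly R}).
Local Notation N := (PPnum p).
Local Notation D := (PPden p).
Local Notation W := (D^`() * N - D * N^`()).
Hypothesis N0 : forall x, N.[x] != 0.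

Lemma gainR_derive (x : R) : is_derive x (1 : R) (gainR p) (W.[x] / N.[x] ^+ 2).
Proof.
have dV := is_deriveV (N0 x) (is_derive_poly N x).
have dM := is_deriveM (is_derive_poly D x) dV.
apply: (is_derive_eq dM).
rewrite hornerD hornerN !hornerM.
rewrite -[LHS]/(D.[x] * (- N.[x] ^- 2 * N^`().[x]) + N.[x]^-1 * D^`().[x]).
by field.
Qed.

(** [W] is the numerator of the derivative of the gain, so by Rolle two equal values would enclose a
    zero of [W]. *)
Lemma gainR_inj a b : (forall x, a < x < b -> ~~ root W x) ->
  {in `[a, b] &, injective (gainR p)}.
Proof.
move=> noW.
suff key x y : a <= x -> y <= b -> x < y -> gainR p x <> gainR p y.
  move=> x y; rewrite !in_itv/= => /andP[ax xb] /andP[ay yb] e.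
  by case: (ltgtP x y) => // xy; [case: (key x y)|case: (key y x)].
move=> ax yb xy e.
have [||z] := Rolle xy _ _ e.
- by move=> z _; have [] := gainR_derive z.
- apply: continuous_subspaceT => z; exact: gainR_continuous.
rewrite in_itv/= => /andP[xz zy] dz.
have := noW z; rewrite (le_lt_trans ax xz) (lt_le_trans zy yb) => /(_ isT)/negP[].
have := @derive_val _ _ _ _ _ _ _ (gainR_derive z); rewrite (@derive_val _ _ _ _ _ _ _ dz).
move/esym/eqP; rewrite mulf_eq0 invr_eq0 expf_eq0/= (negbTE (N0 z)) orbF.
by move=> ?; exact/rootP/eqP.
Qed.

Lemma gainR_cst : W = 0 -> forall x y, gainR p x = gainR p y.
Proof.
move=> W0 x y; apply: is_derive_0_is_cst => z.
by apply: (is_derive_eq (gainR_derive z)); rewrite W0 horner0 mul0r.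
Qed.

End RationalGain.

(** * Polynomials of even degree without real zeros *)

Section NoRealZero.
Variables (R : realType) (n : nat) (p : {poly R}).
Hypotheses (n_gt0 : (0 < n)%N) (n_even : ~~ odd n) (size_p : size p = n.+1).
Hypothesis p_rootless : forall x, ~~ root p x.

Local Notation N := (PPnum p).
Local Notation D := (PPden p).
Local Notation q := (n.-1%:R *: (p^`() ^+ 2) - n%:R *: (p * p^`(2))).

Let size_p_odd : odd (size p). Proof. by rewrite size_p. Qed.

Let n_gt1 : (1 < n)%N.
Proof. by case: n n_gt0 n_even => [|[]]. Qed.

Let size_dp : size p^`() = n. Proof. by rewrite size_deriv size_p. Qed.

Let size_ddp : size p^`(2) = n.-1.
Proof. by rewrite derivnS derivn1 size_deriv size_dp. Qed.

Let p_neq0 : p != 0. Proof. by rewrite -size_poly_gt0 size_p. Qed.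
Let dp_neq0 : p^`() != 0. Proof. by rewrite -size_poly_gt0 size_dp. Qed.
Let ddp_neq0 : p^`(2) != 0.
Proof. by rewrite -size_poly_gt0 size_ddp -subn1 subn_gt0. Qed.

Lemma lead_coef_dp : lead_coef p^`() = lead_coef p * n%:R.
Proof. by rewrite !lead_coefE size_dp size_p coef_deriv prednK// mulr_natr. Qed.

Lemma lead_coef_ddp : lead_coef p^`(2) = lead_coef p * n%:R * n.-1%:R.
Proof.
rewrite lead_coefE size_ddp derivnS derivn1 coef_deriv -lead_coef_dp lead_coefE size_dp.
by rewrite prednK ?mulr_natr// -subn1 subn_gt0.
Qed.

Let horner_q x : q.[x] = n.-1%:R * p^`().[x] ^+ 2 - n%:R * (p.[x] * (p^`(2)).[x]).
Proof. by rewrite hornerD hornerN !hornerZ horner_exp hornerM. Qed.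

Lemma ddp_root_q_root z : root p^`(2) z -> exists x, root q x.
Proof.
move=> /eqP ddpz.
have [x /eqP dpx pddp] := critical_point p_rootless size_p_odd.
apply: (@poly_ivt_le _ q x z); rewrite horner_q.
  by rewrite dpx expr0n mulr0 add0r oppr_le0 mulr_ge0.
by rewrite ddpz !mulr0 subr0 mulr_ge0// sqr_ge0.
Qed.

Lemma dp_roots_ddp_root x y : x < y -> root p^`() x -> root p^`() y ->
  exists z, root p^`(2) z.
Proof.
move=> xy /eqP px /eqP py.
have [|z _ z0] := @poly_rolle _ x y p^`() xy; first by rewrite px.
by exists z; rewrite derivnS derivn1; apply/eqP.
Qed.

Lemma dp_multiple_ddp_root x : (1 < \mu_x p^`())%N -> root p^`(2) x.
Proof.
move=> m; rewrite derivnS derivn1; apply: root_deriv_mu => //.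
by rewrite -mu_gt0// ltnW.
Qed.

Lemma dp_simple_ddp x : root p^`() x -> \mu_x p^`() = 1%N -> ~~ root p^`(2) x.
Proof.
by move=> r m; rewrite -mu_gt0// derivnS derivn1 mu_deriv// m.
Qed.

Lemma dp_root : exists x, root p^`() x.
Proof. by have [x] := critical_point p_rootless size_p_odd; exists x. Qed.

(** [p'] has odd degree, hence an odd number of real zeros with multiplicity: two distinct ones
    force a third. The parity is read off by comparing the signs at [-oo] and [+oo]. *)
Lemma dp_two_roots_sharp x y : x < y -> root p^`() x -> root p^`() y ->
  (3%:E <= sharp_r p^`())%E.
Proof.
move=> xy rx ry; rewrite /sharp_r (negbTE dp_neq0) lee_fin ler_nat.
pose a := - cauchy_bound p^`() - 1.
have noroot_a z : z <= a -> ~~ root p^`() z.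
  move=> za; apply: (le_cauchy_bound dp_neq0); rewrite in_itv/=.
  by rewrite (le_trans za)// /a gerBl.
have nb : nb_zeros_right p^`() a = (\sum_(z <- rootsR p^`()) \mu_z p^`())%N.
  rewrite /nb_zeros_right big_seq_cond [RHS]big_seq_cond; apply: eq_bigl => z.
  rewrite andbT; case: (boolP (z \in _)) => //=; rewrite mem_rootsR// => rz.
  by rewrite ltNge; apply/negP => /noroot_a; rewrite rz.
rewrite -nb.
have oddnb : odd (nb_zeros_right p^`() a).
  have := sg_zeros_right (noroot_a a (lexx a)).
  have -> : Num.sg (p^`()).[a] = sgp_minfty p^`().
    apply: (@sgp_minftyP _ a) => [z|]; rewrite in_itv/= ?lexx//; exact: noroot_a.
  have lc0 : lead_coef p^`() != 0 by rewrite lead_coef_eq0.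
  rewrite /sgp_minfty size_dp sgrM => /mulIf; rewrite sgr_eq0 => /(_ lc0).
  rewrite sgrX sgrN1 -[LHS]signr_odd -[RHS]signr_odd => /eqP.
  rewrite (inj_eq (@signr_inj _)) => /eqP <-.
  by move: n_even; case: n n_gt0 => //= m; rewrite negbK.
have : (1 < nb_zeros_right p^`() a)%N.
  rewrite nb (big_rem x) ?mem_rootsR//= (big_rem y)/=; last first.
    by rewrite (mem_rem_uniq _ (uniq_rootsR _)) inE mem_rootsR// ry gt_eqF.
  rewrite addnA ltn_addr// (@leq_add 1 1)// mu_gt0//.
by case: (nb_zeros_right _ _) oddnb => [|[|[]]].
Qed.

(* This is why [Gamma212] and [Gamma232] are empty. *)
Lemma even_zeros_right x : root p^`() x -> ~~ root p^`(2) x ->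
  (forall y, root p^`() y -> y = x) -> ~~ odd (nb_zeros_right p^`(2) x).
Proof.
move=> rx nrx uniqx.
have [x0 rx0] := critical_point p_rootless size_p_odd.
rewrite (uniqx _ rx0) => pddp.
have pddp0 : 0 < p.[x] * (p^`(2)).[x].
  by rewrite lt_def pddp andbT mulf_neq0//; exact: p_rootless.
have := sg_zeros_right nrx; rewrite lead_coef_ddp.
have nn : 0 < n%:R * n.-1%:R :> R by rewrite mulr_gt0 ?ltr0n// -subn1 subn_gt0.
rewrite -mulrA sgrM (gtr0_sg nn) mulr1.
(* [p] never changes sign, so the common sign of the leading coefficients of [p] and [p''] is the
   sign of [p] at [x], which is also that of [p''] at [x]. *)
have -> : Num.sg (lead_coef p) = Num.sg p.[x].
  rewrite -[LHS]/(sgp_pinfty p); symmetry; apply: (@sgp_pinftyP _ x); last by rewrite in_itv/= lexx.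
  by move=> y _; exact: p_rootless.
move=> e; have : Num.sg (p.[x] * (p^`(2)).[x]) = 1 by rewrite gtr0_sg.
rewrite sgrM e mulrCA -expr2 sqr_sg (p_rootless x : p.[x] != 0) mulr1 -signr_odd.
by case: odd => //=; rewrite expr1 => e1; have := @ltr01 R; rewrite -e1 ltr0N1.
Qed.

(** * The gain when [p''] has no real zeros either *)

Section Gamma1.
Hypothesis ddp_rootless : forall x, ~~ root p^`(2) x.

Let pddp_gt0 x : 0 < p.[x] * (p^`(2)).[x].
Proof.
have [x0 _ pddp] := critical_point p_rootless size_p_odd.
rewrite -hornerM; apply: (@rootless_sg _ _ x0).
  by move=> z; rewrite rootM negb_or p_rootless ddp_rootless.
rewrite hornerM lt_def pddp andbT mulf_neq0//; [exact: p_rootless|exact: ddp_rootless].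
Qed.

Local Notation G := (gcdp (p^`(2) * p) (p^`() ^+ 2)).

Let numE : N * G = p^`(2) * p. Proof. exact/divpK/dvdp_gcdl. Qed.
Let denE : D * G = p^`() ^+ 2. Proof. exact/divpK/dvdp_gcdr. Qed.

Let num_G_neq0 x : N.[x] * G.[x] != 0.
Proof. by rewrite -hornerM numE hornerM mulrC gt_eqF. Qed.

Let N0 x : N.[x] != 0.
Proof. by apply: contraNneq (num_G_neq0 x) => ->; rewrite mul0r. Qed.

Let G0 x : G.[x] != 0.
Proof. by apply: contraNneq (num_G_neq0 x) => ->; rewrite mulr0. Qed.

Lemma gainRE x : gainR p x = p^`().[x] ^+ 2 / (p.[x] * (p^`(2)).[x]).
Proof.
have := congr1 (horner^~ x) numE; have := congr1 (horner^~ x) denE.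
rewrite /= hornerM horner_exp => <-; rewrite hornerM [RHS]hornerM mulrC => e.
rewrite [p.[x] * _]mulrC -e /gainR; move: (N0 x) (G0 x).
by move: N.[x] D.[x] G.[x] => u v w u0 w0; field; rewrite u0 w0.
Qed.

Let gain_ge0 x : 0 <= gainR p x.
Proof. by rewrite gainRE divr_ge0 ?sqr_ge0// ltW. Qed.

Let coND : coprimep N D.
Proof. by rewrite coprimep_div_gcd// mulf_neq0. Qed.

Let n1_gt0 : 0 < n.-1%:R :> R.
Proof. by rewrite ltr0n -subn1 subn_gt0. Qed.

Let q_gain x : (root q x) = (gainR p x == n%:R / n.-1%:R).
Proof.
rewrite /root horner_q gainRE subr_eq0 eqr_div ?lt0r_neq0//.
by rewrite [_ ^+ 2 * _]mulrC.
Qed.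

Lemma K0E : K0 p = (n%:R / n.-1%:R)%:E.
Proof. by rewrite /K0 size_p. Qed.

Let gainR_crit x : root p^`() x -> gainR p x = 0.
Proof. by move=> /eqP px; rewrite gainRE px expr0n mul0r. Qed.

(** At the critical point [q] is nonpositive, while a gain of at least [n / (n - 1)] at [b] says
    exactly that [q] is nonnegative there. *)
Lemma high_gain_q_root b : (K0 p <= gain p b%:C)%E -> exists x, root q x.
Proof.
rewrite gain_real// K0E lee_fin gainRE => Kb.
have [x /eqP dpx pddp] := critical_point p_rootless size_p_odd.
apply: (@poly_ivt_le _ q x b); rewrite horner_q.
  by rewrite dpx expr0n mulr0 add0r oppr_le0 mulr_ge0.
move: Kb; rewrite ler_pdivlMr// mulrAC ler_pdivrMr// subr_ge0.
by rewrite [_ ^+ 2 * _]mulrC.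
Qed.

Let size_ddp_mul : size (p^`(2) * p) = (n + n).-1.
Proof.
rewrite size_mul// size_ddp size_p; move: n_gt0; lia.
Qed.

Let size_deriv_sq : size (p^`() ^+ 2) = (n + n).-1.
Proof. by rewrite expr2 size_mul// size_dp. Qed.

(** If the gain never exceeds [n / (n - 1)], a zero of [q] is itself a maximum. Otherwise some value
    exceeds the limit at infinity, and the maximum is attained on a bounded interval. *)
Lemma gain_max : (exists x, root q x) ->
  exists2 b, forall x, gainR p x <= gainR p b & n%:R / n.-1%:R <= gainR p b.
Proof.
move=> [x1]; rewrite q_gain => /eqP Kx1.
have [[x2 Kx2]|K_le] := pselect (exists x, n%:R / n.-1%:R < gainR p x); last first.
  exists x1; rewrite Kx1// => x; rewrite leNgt; apply/negP => Kx.
  by apply: K_le; exists x.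
(* [r] is positive exactly where the gain times [p p''] is below [K x2] times [p p'']. Its
   coefficient of degree [2n - 2] has the sign of [K x2 * (n - 1) - n], so [r] is positive far out
   on both sides. *)
pose r := gainR p x2 *: (p^`(2) * p) - p^`() ^+ 2.
have rc : 0 < r`_((n + n).-2).
  have -> : r`_(n + n).-2 = gainR p x2 * lead_coef (p^`(2) * p) - lead_coef (p^`() ^+ 2).
    by rewrite [in RHS]lead_coefE size_ddp_mul [in RHS]lead_coefE size_deriv_sq coefD coefN coefZ.
  rewrite lead_coefM lead_coef_exp lead_coef_dp lead_coef_ddp.
  move: Kx2; rewrite ltr_pdivrMr// => Kx2.
  have lc2 : 0 < lead_coef p ^+ 2 * n%:R.
    by rewrite mulr_gt0 ?ltr0n// exprn_even_gt0//= lead_coef_eq0.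
  rewrite [X in 0 < X](_ : _ = lead_coef p ^+ 2 * n%:R * (gainR p x2 * n.-1%:R - n%:R)).
    by rewrite mulr_gt0// subr_gt0.
  by ring.
have szr' : size r = (n + n).-1.
  have nn : (0 < (n + n).-1)%N by case: n n_gt1 => [|[|m]]//; rewrite addSn addnS.
  apply/anti_leq/andP; split.
    rewrite (leq_trans (size_polyD _ _))// geq_max size_polyN size_deriv_sq leqnn andbT.
    by rewrite (leq_trans (size_scale_leq _ _))// size_ddp_mul.
  rewrite -(prednK nn) ltnNge; apply/negP => /(nth_default 0) r0.
  by rewrite r0 ltxx in rc.
have r_odd : odd (size r).
  rewrite szr'; case: n n_gt0 => // m _; rewrite addSn addnS/= addnn odd_double//.
have r_lead : 0 < lead_coef r by rewrite lead_coefE szr'.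
have [X X0 rX] := even_degree_pos r_lead r_odd.
have [||b bmax] := @continuous_max_attained _ (gainR p) x2 X.
- exact: gainR_continuous.
- move=> x /rX; rewrite hornerD hornerN hornerZ hornerM horner_exp subr_gt0.
  by rewrite [in gainR p x]gainRE ler_pdivrMr// [p.[x] * _]mulrC => /ltW.
by exists b => //; rewrite (le_trans (ltW Kx2)).
Qed.

Lemma q_root_max_breakaway : (exists x, root q x) ->
  exists2 b, max_real_breakaway p b & (K0 p <= gain p b%:C)%E.
Proof.
move=> /gain_max[b bmax Kb]; exists b; last by rewrite gain_real// K0E lee_fin.
have Kb0 : 0 < gainR p b by apply: lt_le_trans Kb; rewrite divr_gt0// ltr0n.
have [x0 rx0] := dp_root.
pose W := D^`() * N - D * N^`().
(* The gain is not constant: it vanishes at [x0] and is positive at [b]. *)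
have W0 : W != 0.
  apply/eqP => W0; have := gainR_cst N0 W0 x0 b; rewrite gainR_crit// => Kb_eq.
  by rewrite -Kb_eq ltxx in Kb0.
have D0 : D != 0.
  by apply: contraTneq Kb0; rewrite /gainR => ->; rewrite horner0 mul0r ltxx.
have WD0 : W * D != 0 by rewrite mulf_neq0.
have Dx0 : root D x0.
  have /eqP := gainR_crit rx0; rewrite mulf_eq0 invr_eq0 (negbTE (N0 x0)) orbF.
  exact.
have Gn0 : G != 0 by apply: contraNneq (G0 0) => ->; rewrite horner0.
have Nn0 : N != 0 by apply: contraNneq (N0 0) => ->; rewrite horner0.
(* [p p''] and [p'^2] have the same degree, hence so do [N] and [D]; as [D] has a root, [N] is not
   constant and has a complex root. *)
have szND : size N = size D.
  have := congr1 (fun f : {poly R} => size f) numE.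
  have := congr1 (fun f : {poly R} => size f) denE.
  rewrite /= size_deriv_sq size_ddp_mul => <-; rewrite !size_mul//.
  by rewrite -(prednK (_ : 0 < size G)%N) ?size_poly_gt0// !addnS/= => /addIn.
have ltb : b - 1 < b by rewrite gtrBl.
have gtb : b < b + 1 by rewrite ltrDl.
(* Between [b] and the midpoints [a] and [c] there is no zero of [W], so the gain is injective on
   each side, and no zero of [D], so it is positive at [a] and [c]. *)
pose a := (prev_root (W * D) (b - 1) b + b) / 2.
pose c := (next_root (W * D) b (b + 1) + b) / 2.
have pr := prev_root_lt ltb WD0; have nr := next_root_gt gtb WD0.
have [ab bc] : a < b /\ b < c by rewrite /a /c; split; lra.
have nol x : a <= x < b -> ~~ root (W * D) x.
  move=> /andP[ax xb]; apply: (@prev_noroot _ (W * D) (b - 1) b).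
  by rewrite in_itv/= xb andbT (lt_le_trans _ ax)// /a; lra.
have nor x : b < x <= c -> ~~ root (W * D) x.
  move=> /andP[bx xc]; apply: (@next_noroot _ (W * D) b (b + 1)).
  by rewrite in_itv/= bx/= (le_lt_trans xc)// /c; lra.
have Kpos x : ~~ root (W * D) x -> 0 < gainR p x.
  rewrite rootM negb_or => /andP[_ Dx]; rewrite lt_def gain_ge0 andbT.
  by rewrite /gainR mulf_neq0// invr_eq0.
apply: (@max_breakaway _ p coND N0 gain_ge0 a b c) => //.
- by rewrite ab.
- by apply/Kpos/nol; rewrite lexx.
- by apply/Kpos/nor; rewrite lexx andbT.
- apply: gainR_inj => // x /andP[ax xb]; have := nol x; rewrite (ltW ax) xb => /(_ isT).
  by rewrite rootM negb_or => /andP[].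
- apply: gainR_inj => // x /andP[bx xc]; have := nor x; rewrite (ltW xc) bx => /(_ isT).
  by rewrite rootM negb_or => /andP[].
- by apply/closed_rootP; rewrite size_map_poly szND gtn_eqF// (root_size_gt1 D0 Dx0).
- by exists x0%:C; rewrite /root horner_map (eqP Dx0).
Qed.

End Gamma1.
End NoRealZero.

(** * Comparison of the classes with the real zeros of [q] *)

Lemma Gamma_p0 (R : realType) (p : {poly R}) : p^`() != 0 -> Gamma p ->
  [/\ root p^`() (p0 p), forall y, root p^`() y -> y = p0 p
    & \mu_(p0 p) p^`() = 1%N].
Proof.
move=> dp0 [_ [x [rx mx]]].
have -> : p0 p = x.
  rewrite /p0; case E: (rootsR p^`()) => [|y s] /=.
    by have := mem_rootsR x dp0; rewrite E in_nil (iffRL (rx x) erefl).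
  by apply/rx; rewrite -mem_rootsR// E mem_head.
by split=> // [|y /rx]; [apply/rx|].
Qed.

Theorem theorem1p11 (R : realType) (n : nat) (p : {poly R})
    (hn : (0 < n)%N) (hev : ~~ odd n) (hp : size p = n.+1) :
  (0 < sharp_r (n.-1%:R *: (p^`() ^+ 2) - n%:R *: (p * p^`(2))) + sharp_r p)%E
  <->
  (@Lambda1 R `|` @Lambda21 R `|` @Lambda22 R `|` @Gamma122 R `|` @Gamma22 R
    `|` @Gamma2122 R `|` @Gamma211 R `|` @Gamma231 R `|` @Gamma2322 R) p.
Proof.
set q := (X in sharp_r X).
have -> : (0 < sharp_r q + sharp_r p)%E <->
    (exists x, root q x) \/ (exists x, root p x).
  rewrite -!sharp_r_gt0; split=> [|[h|h]]; last 2 first.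
  - by rewrite (lt_le_trans h)// leeDl// sharp_r_ge0.
  - by rewrite (lt_le_trans h)// leeDr// sharp_r_ge0.
  have := sharp_r_ge0 q; rewrite le_eqVlt => /orP[/eqP <-|]; last by left.
  by rewrite add0e; right.
have [rp|nrp] := pselect (exists x, root p x).
  by split=> _; [do 8! left|right].
have p0_ x : ~~ root p x by apply/negP => px; apply: nrp; exists x.
have dp0 : p^`() != 0 by rewrite -size_poly_gt0 size_deriv hp.
have ddpq z : root p^`(2) z -> exists x, root q x.
  exact: (ddp_root_q_root hev hp p0_).
(* Consequently a real zero of [p''] to the right of [p0] places [p] in [Gamma211] or [Gamma231],
   according to whether there is none or some to the left. *)
have parity : Gamma p -> ~~ odd (nb_zeros_right p^`(2) (p0 p)).
  move=> /(Gamma_p0 dp0)[r0 u0 m0]; apply: (even_zeros_right hn hev hp p0_ r0 _ u0).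
  exact: (dp_simple_ddp hn hev hp r0 m0).
split=> [[[x qx]|//]|cls]; last first.
  left; case: cls => [[[[[[[[|]|]|]|]|]|]|]|].
  - by [].
  (* A multiple zero of [p'] is a zero of [p'']. If all zeros are simple, a count of at least three
     leaves two distinct ones, and Rolle applies. *)
  - move=> [_ sh _]; have [[x mx]|nmx] := pselect (exists x, (1 < \mu_x p^`())%N).
      exact/(ddpq x)/(dp_multiple_ddp_root hn hp).
    move: sh; rewrite /sharp_r (negbTE dp0) lee_fin ler_nat.
    have rts z : z \in rootsR p^`() -> root p^`() z by rewrite mem_rootsR.
    have := uniq_rootsR p^`(); case: (rootsR p^`()) rts => [|x [|y s]] rts.
    + by rewrite big_nil.
    + rewrite big_seq1 => _ mx; case: nmx; exists x; exact: ltnW.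
    + rewrite /= inE negb_or => /andP[/andP[xy _] _] _.
      have rx : root p^`() x by apply: rts; rewrite mem_head.
      have ry : root p^`() y by apply: rts; rewrite !inE eqxx orbT.
      have [z /ddpq//] : exists z, root p^`(2) z.
      by case: (ltgtP x y) xy => // h _; apply: (dp_roots_ddp_root h).
  - by move=> [_ [x [_ mx]]]; exact/(ddpq x)/(dp_multiple_ddp_root hn hp).
  - move=> [[[_ nr] _] [b _ Kb]]; apply: (high_gain_q_root hn hev hp p0_ _ Kb) => x.
    by apply/negP => rx; apply: nr; exists x.
  - by move=> [[_ [z /ddpq]]].
  - by move=> [[[[_ [z /ddpq]]]]].
  - by move=> [[[_ [z /ddpq]]]].
  - by move=> [[[_ [z /ddpq]]]].
  - by move=> [[[[_ [z /ddpq]]]]].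
have [x0 rx0] := dp_root hev hp p0_.
have L2 : Lambda2 p by [].
have [[y yx ry]|uniqx] := pselect (exists2 y, y != x0 & root p^`() y).
  do 7! left; right; split=> //; last by move=> _; exists y, x0.
  by case: (ltgtP y x0) yx => // h _; apply: (dp_two_roots_sharp hn hev hp h).
have ux y : root p^`() y <-> y = x0.
  split=> [ry|->//]; apply/eqP; apply/negPn/negP => yx; apply: uniqx; by exists y.
have [m1|m1] := ltnP 1 (\mu_x0 p^`()).
  by do 6! left; right; split=> //; exists x0.
have m1' : \mu_x0 p^`() = 1%N by apply/anti_leq; rewrite m1 mu_gt0.
have Gp : Gamma p by split=> //; exists x0.
have [[z rz]|nz] := pselect (exists z, root p^`(2) z); last first.
  have ddp_rl y : ~~ root p^`(2) y by apply/negP => ry; apply: nz; exists y.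
  have [|b mb Kb] := q_root_max_breakaway hn hev hp p0_ ddp_rl; first by exists x.
  do 5! left; right; split; last by exists b.
  by split=> //; exists b; case: mb.
have G2 : Gamma2 p by split=> //; exists z.
have [r0 u0 m0] := Gamma_p0 dp0 Gp.
(* [p0] is a simple zero of [p'], so every real zero of [p''] lies strictly on one side of it and
   the final case split is exhaustive. *)
have p0N y : root p^`(2) y -> y != p0 p.
  move=> ry; apply: contraTneq ry => ->; exact: (dp_simple_ddp hn hev hp r0 m0).
have [right_|noright] := pselect (exists z, zero_right p z);
  have [left_|noleft] := pselect (exists z, zero_left p z).
- by left; right; split; [split|exact: parity].
- by do 2! left; right; split; [split|exact: parity].
- by do 4! left; right; split.
- by case: (ltgtP z (p0 p)) (p0N _ rz) => // h _; [case: noleft|case: noright]; exists z.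
Qed.
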